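(* For every $\mathcal{TEL}^{\bigcirc}_{\mathit{future}}$-TBox $\mathcal{T}$, one can construct in polynomial time a unary conjunctive grammar $G_\mathcal{T}=(N,\{c\},R)$ such that for any concept names $A,B$ occurring in $\mathcal{T}$ there is a nonterminal $\mathcal{N}_{AB}\in N$ such that for all $n\in\mathbb{N}$: $c^n\in L_{G_\mathcal{T}}(\mathcal{N}_{AB})$ if and only if $\mathcal{T}\models A\sqsubseteq\bigcirc^nB$.
   Context: Fix disjoint sets of concept names, role names (partitioned into rigid and local ones) and individual names. A $\mathcal{TEL}^{\bigcirc}$-TBox is a finite set of concept inclusions $A\sqsubseteq\bigcirc^nB$, $A\sqcap A'\sqsubseteq B$, $\exists r.A\sqsubseteq B$, $A\sqsubseteq\exists r.B$ ($A,A',B$ concept names, $r$ role name, $n\in\mathbb{Z}$, $\bigcirc^0B=B$); it is a $\mathcal{TEL}^{\bigcirc}_{\mathit{future}}$-TBox if all such $n$ satisfy $n\ge 0$. Semantics: an interpretation is a family $(\mathcal{I}_i)_{i\in\mathbb{Z}}$ of classical DL interpretations over a common domain (individual names interpreted as themselves), where rigid role names have the same interpretation at all $i$; $(\bigcirc^nA)^{i}=A^{i+n}$, $\sqcap$ is intersection, $(\exists r.A)^i=\{d\mid\exists e\in A^i,(d,e)\in r^i\}$; $C\sqsubseteq D$ holds if $C^i\subseteq D^i$ for all $i$; $\mathcal{T}\models C\sqsubseteq D$ means every model of $\mathcal{T}$ satisfies $C\sqsubseteq D$. Size of a TBox counts integers in unary. A conjunctive grammar is $G=(N,\Sigma,R)$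 with disjoint finite alphabets $N$ (nonterminals) and $\Sigma$ (terminals) and finitely many rules $\mathcal{N}\to\alpha_1\&\dots\&\alpha_n$ ($n\ge1$, $\alpha_i\in(N\cup\Sigma)^*$). Semantics: the propositions $X(w)$ ($X\in N\cup\Sigma$, $w\in\Sigma^*$) derivable from axioms $c(c)$ for $c\in\Sigma$ using, for each rule $\mathcal{N}\to\alpha_1\&\dots\&\alpha_n$ with $\alpha_i=X^i_1\cdots X^i_{k_i}$ and all words $u^i_j$ with $u^1_1\cdots u^1_{k_1}=\dots=u^n_1\cdots u^n_{k_n}=w$, the inference from all $X^i_j(u^i_j)$ to $\mathcal{N}(w)$; $L_G(X)=\{w\mid X(w)\text{ derivable}\}$. It is unary if $\Sigma=\{c\}$. *)

(* Defs.v *)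
From Stdlib Require List.
From mathcomp Require Import all_boot all_order all_algebra.

Set Implicit Arguments.
Unset Strict Implicit.
Unset Printing Implicit Defensive.

(** * Temporal EL *)

(* The three sets of names are separate types, hence disjoint; the local role
   names are those that are not rigid.  The [_word] fields say how a name is
   written down as a binary word when a TBox is given to a machine; they play
   no role in the semantics. *)
Record vocabulary := Vocabulary {
  cname : eqType;
  rname : eqType;
  iname : Type;
  rigid : pred rname;
  cname_word : cname -> seq bool;
  rname_word : rname -> seq bool;
  cname_word_inj : injective cname_word;
  rname_word_inj : injective rname_word
}.

Section TEL.
Variable V : vocabulary.

Inductive concept :=
| Next of int & cname V
| Meet of cname V & cname V
| Some_of of rname V & cname V.

(* The concept name A itself: A = ○^0 A. *)
Definition Name (A : cname V) : concept := Next 0 A.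

Inductive inclusion :=
| SubNext of cname V & int & cname V
| MeetSub of cname V & cname V & cname V
| ExSub of rname V & cname V & cname V
| SubEx of cname V & rname V & cname V.

Definition lhs (a : inclusion) : concept :=
  match a with
  | SubNext A _ _ => Name A
  | MeetSub A A' _ => Meet A A'
  | ExSub r A _ => Some_of r A
  | SubEx A _ _ => Name A
  end.

Definition rhs (a : inclusion) : concept :=
  match a with
  | SubNext _ n B => Next n B
  | MeetSub _ _ B => Name B
  | ExSub _ _ B => Name B
  | SubEx _ r B => Some_of r B
  end.

Definition tbox := seq inclusion.

Definition future (T : tbox) : Prop :=
  forall A n B, List.In (SubNext A n B) T -> (0 <= n)%R.

Definition inclusion_cnames (a : inclusion) : seq (cname V) :=
  match a with
  | SubNext A _ B => [:: A; B]
  | MeetSub A A' B => [:: A; A'; B]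
  | ExSub _ A B => [:: A; B]
  | SubEx A _ B => [:: A; B]
  end.

Definition tbox_cnames (T : tbox) : seq (cname V) :=
  flatten [seq inclusion_cnames a | a <- T].

(* Individual names are interpreted as themselves: the domain contains a copy
   of [iname V], given by the injection [ind]. *)
Record interpretation := Interpretation {
  dom : Type;
  dom_nonempty : inhabited dom;
  ind : iname V -> dom;
  ind_inj : injective ind;
  cext : int -> cname V -> dom -> Prop;
  rext : int -> rname V -> dom -> dom -> Prop;
  rext_rigid : forall r, rigid r ->
    forall i j d e, rext i r d e <-> rext j r d e
}.

Definition ext (I : interpretation) (i : int) (C : concept) (d : dom I) : Prop :=
  match C with
  | Next n A => cext (i + n)%R A d
  | Meet A A' => cext i A d /\ cext i A' d
  | Some_of r A => exists e, cext i A e /\ rext i r d e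
  end.

Definition satisfies (I : interpretation) (C D : concept) : Prop :=
  forall i (d : dom I), ext i C d -> ext i D d.

Definition model (I : interpretation) (T : tbox) : Prop :=
  forall a, List.In a T -> satisfies I (lhs a) (rhs a).

Definition entails (T : tbox) (C D : concept) : Prop :=
  forall I : interpretation, model I T -> satisfies I C D.

End TEL.

(** * Conjunctive grammars *)

(* (X, a1, [:: a2; ...; an]) is the rule X -> a1 & a2 & ... & an; keeping a1
   apart enforces n >= 1. *)
Definition rule (N Sigma : finType) : Type :=
  (N * seq (N + Sigma) * seq (seq (N + Sigma)))%type.

Definition rule_head (N Sigma : finType) (rho : rule N Sigma) : N := rho.1.1.

Definition conjuncts (N Sigma : finType) (rho : rule N Sigma) :
  seq (seq (N + Sigma)) := rho.1.2 :: rho.2.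

Record conj_grammar (N Sigma : finType) :=
  ConjGrammar { rules : seq (rule N Sigma) }.

(* [derives_seq G (X1 ... Xk) w] holds when w = u1 ... uk with each Xj(uj)
   derivable. *)
Inductive derives (N Sigma : finType) (G : conj_grammar N Sigma) :
    N + Sigma -> seq Sigma -> Prop :=
| derives_axiom c : derives G (inr c) [:: c]
| derives_rule rho w :
    rho \in rules G ->
    (forall a, a \in conjuncts rho -> derives_seq G a w) ->
    derives G (inl (rule_head rho)) w
with derives_seq (N Sigma : finType) (G : conj_grammar N Sigma) :
    seq (N + Sigma) -> seq Sigma -> Prop :=
| derives_nil : derives_seq G [::] [::]
| derives_cons X a u v :
    derives G X u -> derives_seq G a v -> derives_seq G (X :: a) (u ++ v).

Definition language (N Sigma : finType) (G : conj_grammar N Sigma)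
    (X : N + Sigma) (w : seq Sigma) : Prop :=
  derives G X w.

(* The terminal alphabet of a unary grammar is {c} with c := tt. *)
Record unary_grammar := UnaryGrammar {
  nonterminal : finType;
  grammar :> conj_grammar nonterminal unit
}.

(** * Encodings as binary words *)

(* Every element is announced by 1 and the end of the list is marked by 0, so
   that code_list f is prefix-free as soon as f is. *)
Definition code_list (X : Type) (f : X -> seq bool) (s : seq X) : seq bool :=
  flatten [seq true :: f x | x <- s] ++ [:: false].

Definition code_word (w : seq bool) : seq bool := code_list (fun b => [:: b]) w.

Definition code_unary (n : nat) : seq bool := nseq n true ++ [:: false].

Definition code_int (n : int) : seq bool := (n < 0)%R :: code_unary `|n|%N.

Definition code_cname (V : vocabulary) (A : cname V) : seq bool :=
  code_word (cname_word A).

Definition code_rname (V : vocabulary) (r : rname V) : seq bool :=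
  rigid r :: code_word (rname_word r).

Definition code_inclusion (V : vocabulary) (a : inclusion V) : seq bool :=
  match a with
  | SubNext A n B =>
      [:: false; false] ++ code_cname A ++ code_int n ++ code_cname B
  | MeetSub A A' B =>
      [:: false; true] ++ code_cname A ++ code_cname A' ++ code_cname B
  | ExSub r A B =>
      [:: true; false] ++ code_rname r ++ code_cname A ++ code_cname B
  | SubEx A r B =>
      [:: true; true] ++ code_cname A ++ code_rname r ++ code_cname B
  end.

Definition code_tbox (V : vocabulary) (T : tbox V) : seq bool :=
  code_list (@code_inclusion V) T.

(* Symbols are identified by their position in the enumeration of their
   alphabet. *)
Definition code_symbol (N Sigma : finType) (X : N + Sigma) : seq bool :=
  match X with
  | inl A => false :: code_unary (enum_rank A)
  | inr c => true :: code_unary (enum_rank c)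
  end.

Definition code_rule (N Sigma : finType) (rho : rule N Sigma) : seq bool :=
  code_unary (enum_rank (rule_head rho)) ++
  code_list (code_list (@code_symbol N Sigma)) (conjuncts rho).

Definition code_grammar (N Sigma : finType) (G : conj_grammar N Sigma) :
  seq bool :=
  code_unary #|N| ++ code_unary #|Sigma| ++
  code_list (@code_rule N Sigma) (rules G).

(** * Polynomial-time computability *)

(* Deterministic multi-tape Turing machines; a tape cell holds a bit or is
   blank ([None]). *)
Inductive move := MoveLeft | Stay | MoveRight.

Definition cell := option bool.

(* There are [ntapes.+1] tapes.  [delta q s = None] means that the machine
   halts in state q when reading the symbols s. *)
Record machine := Machine {
  state : finType;
  ntapes : nat;
  start : state;
  delta : state -> {ffun 'I_ntapes.+1 -> cell} ->
          option (state * {ffun 'I_ntapes.+1 -> cell * move})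
}.

(* Cells left of the head (nearest first), scanned cell, cells right of the
   head; all cells beyond the two lists are blank. *)
Definition tape : Type := (seq cell * cell * seq cell)%type.

Definition scan (t : tape) : cell := t.1.2.

Definition act (t : tape) (b : cell * move) : tape :=
  let: (l, _, r) := t in
  match b.2 with
  | MoveLeft => (behead l, head None l, b.1 :: r)
  | Stay => (l, b.1, r)
  | MoveRight => (b.1 :: l, head None r, behead r)
  end.

(* The head is on the first letter of w. *)
Definition load (w : seq bool) : tape :=
  ([::], head None (map Some w), behead (map Some w)).

Fixpoint bits (s : seq cell) : seq bool :=
  if s is Some b :: s' then b :: bits s' else [::].

(* The word that starts at the head and ends before the first blank. *)
Definition contents (t : tape) : seq bool := bits (t.1.2 :: t.2).

Definition config (M : machine) : Type :=
  (state M * {ffun 'I_(ntapes M).+1 -> tape})%type.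

Definition init (M : machine) (w : seq bool) : config M :=
  (start M, [ffun i => load (if i == ord0 then w else [::])]).

Definition step (M : machine) (c : config M) : option (config M) :=
  if delta c.1 [ffun i => scan (c.2 i)] is Some (q, b)
  then Some (q, [ffun i => act (c.2 i) (b i)]) else None.

Fixpoint run (M : machine) (n : nat) (c : config M) : config M :=
  if n is n'.+1 then (if step c is Some c' then run n' c' else c) else c.

(* On input w, M halts after at most n steps with output w'. *)
Definition outputs (M : machine) (w : seq bool) (n : nat) (w' : seq bool) :
    Prop :=
  let c := run n (init M w) in step c = None /\ contents (c.2 ord0) = w'.

Definition poly_time_computable (X Y : Type) (codeX : X -> seq bool)
    (codeY : Y -> seq bool) (D : X -> Prop) (f : X -> Y) : Prop :=
  exists (M : machine) (p : {poly nat}), forall x, D x ->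
    outputs M (codeX x) p.[size (codeX x)]%R (codeY (f x)).

(* Main.v *)
(* A grammar symbol N_AB deriving c^n exactly when T |= A <= O^n B is obtained
   from the rules N_AA -> eps, N_AB -> c^n for A <= O^n B in T,
   N_AB -> N_AC N_CB, N_AB -> N_AC & N_AC' for C, C' <= B in T, and
   N_AB -> N_CD for A <= Er.C and Er.D <= B in T, with the extra conjunct eps
   if r is local.  In the canonical model an element is a pair of a concept
   name C and the time i at which C was created; it belongs to D at time i + n
   iff N_CD derives c^n.

   To keep the Turing machine trivial, concept names are represented by the
   positions of the input word at which they are written, and the grammar
   itself parses the input: auxiliary symbols indexed by pairs of positions
   derive eps when "a name is written between x and y", "an axiom starts at
   x", "the same name is written at x and y", and so on.  The grammar is thus
   the set of instances of finitely many clauses over all tuples of positions,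
   and is printed by nested loops over the input. *)
Require Import Defs.
From mathcomp Require Import all_boot all_order all_algebra.
From mathcomp Require Import zify.

Set Implicit Arguments.
Unset Strict Implicit.
Unset Printing Implicit Defensive.

(** * Composing machines *)

(** Why the delays compose: if [A] holds of an element at time i, its r-successor in [C] is created
    at i and may acquire [D] at i + n. The element itself then gets [B] at i + n, provided that the
    edge still exists. A rigid role guarantees this for every n, a local role only for n = 0. In a
    future TBox all shifts are natural numbers, so an element of the canonical model acquires names
    only from its creation on. Delays can therefore be represented by unary words, with
    concatenation as addition and conjunction as acquiring two names at the same time. A symbol that
    derives at most the empty word acts as a side condition in a rule body. The machine thus prints
    ill-formed instances as well: they contain a side condition that derives nothing. One name may
    be written at many positions. The grammar identifies them by a zero delay between equal words,
    so any occurrences of A and B yield a suitable nonterminal. A nonterminal is numbered by a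
    polynomial in its positions and the input length, which nested loops can print in unary. *)

Section Control.
Variable k : nat.

Definition symbols := {ffun 'I_k.+1 -> cell}.
Definition actions := {ffun 'I_k.+1 -> cell * move}.
Definition tapes := {ffun 'I_k.+1 -> tape}.

Record control := Control {
  cstate : finType;
  cstart : cstate;
  cdelta : cstate -> symbols -> option (cstate * actions)
}.

Definition machine_of (P : control) : machine := Machine (@cstart P) (@cdelta P).

Definition scans (ts : tapes) : symbols := [ffun i => scan (ts i)].
Definition acts (ts : tapes) (b : actions) : tapes :=
  [ffun i => act (ts i) (b i)].

Definition cstep (P : control) (q : cstate P) (ts : tapes) :
    option (cstate P * tapes) :=
  if cdelta q (scans ts) is Some (q', b) then Some (q', acts ts b) else None.

Inductive steps (P : control) (q : cstate P) (ts : tapes) :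
    nat -> cstate P -> tapes -> Prop :=
| Steps0 : steps q ts 0 q ts
| StepsS q1 ts1 n q2 ts2 : cstep q ts = Some (q1, ts1) ->
    steps q1 ts1 n q2 ts2 -> steps q ts n.+1 q2 ts2.

Lemma steps_trans (P : control) (q q1 q2 : cstate P) ts ts1 ts2 n n1 :
  steps q ts n q1 ts1 -> steps q1 ts1 n1 q2 ts2 -> steps q ts (n + n1) q2 ts2.
Proof. by elim=> // *; rewrite addSn; econstructor; eauto. Qed.

Lemma steps1 (P : control) (q q1 : cstate P) ts ts1 :
  cstep q ts = Some (q1, ts1) -> steps q ts 1 q1 ts1.
Proof. by move=> h; econstructor; eauto; constructor. Qed.

Definition exec (P : control) (ts ts' : tapes) (t : nat) : Prop :=
  exists q n, [/\ n <= t, steps (cstart P) ts n q ts' & cstep q ts' = None].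

Lemma exec_le P ts ts' t t' : t <= t' -> exec P ts ts' t -> exec P ts ts' t'.
Proof.
by move=> le [q [n [lent st hq]]]; exists q, n; split=> //; apply: leq_trans le.
Qed.

Lemma exec_outputs P w ts t o :
  exec P [ffun i => load (if i == ord0 then w else [::])] ts t ->
  contents (ts ord0) = o -> outputs (machine_of P) w t o.
Proof.
have stepE q us : step ((q, us) : config (machine_of P)) = cstep q us.
  by rewrite /step /cstep /=.
move=> [q [n [le st hq]]] ho.
suff E : run t (init (machine_of P) w) = (q, ts) by split; rewrite E ?stepE.
rewrite /init /=; move: (cstart P) [ffun _ => _] st => q0 us st.
elim: st t le hq => {n ho} [q1 us1|q1 us1 q2 us2 n q3 us3 h1 _ IH] t le hq.
  by case: t {le} => // t; rewrite /= stepE hq.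
by case: t le => // t le; rewrite /= stepE h1; apply: IH.
Qed.

Definition CAct (f : symbols -> actions) : control :=
  @Control bool false (fun q s => if q then None else Some (true, f s)).

Definition idle (s : symbols) : actions := [ffun i => (s i, Stay)].

Definition CSeq (P Q : control) : control :=
  @Control (cstate P + cstate Q)%type (inl (cstart P)) (fun q s =>
    match q with
    | inl p => if cdelta p s is Some (p', b) then Some (inl p', b)
               else Some (inr (cstart Q), idle s)
    | inr p => if cdelta p s is Some (p', b) then Some (inr p', b) else None
    end).

Definition CIf (test : symbols -> bool) (P Q : control) : control :=
  @Control (option (cstate P + cstate Q)%type) None (fun q s =>
    match q with
    | None => Some (Some (if test s then inl (cstart P) else inr (cstart Q)),
                    idle s)
    | Some (inl p) =>
        if cdelta p s is Some (p', b) then Some (Some (inl p'), b) else None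
    | Some (inr p) =>
        if cdelta p s is Some (p', b) then Some (Some (inr p'), b) else None
    end).

Definition CWhile (test : symbols -> bool) (P : control) : control :=
  @Control (option (cstate P)) None (fun q s =>
    match q with
    | None => if test s then Some (Some (cstart P), idle s) else None
    | Some p => if cdelta p s is Some (p', b) then Some (Some p', b)
                else Some (None, idle s)
    end).

Lemma acts_idle ts : acts ts (idle (scans ts)) = ts.
Proof. by apply/ffunP=> i; rewrite !ffunE; case: (ts i) => [[]]. Qed.

Lemma exec_act f ts : exec (CAct f) ts (acts ts (f (scans ts))) 1.
Proof. by exists true, 1; split=> //; apply: steps1. Qed.

Lemma steps_embed (P Q : control) (g : cstate P -> cstate Q) :
  (forall q s p b, cdelta q s = Some (p, b) -> cdelta (g q) s = Some (g p, b)) ->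
  forall q ts n q' ts', steps q ts n q' ts' -> steps (g q) ts n (g q') ts'.
Proof.
move=> hg q ts n q' ts'; elim=> [q0 us|q0 us q1 us1 m q2 us2 h1 _ IH].
  exact: Steps0.
apply: StepsS IH; move: h1; rewrite /cstep.
by case E: (cdelta _ _) => [[p b]|//] [<- <-]; rewrite (hg _ _ _ _ E).
Qed.

Lemma cstep_None (P : control) (q : cstate P) ts :
  cstep q ts = None -> cdelta q (scans ts) = None.
Proof. by rewrite /cstep; case: (cdelta _ _) => [[]|]. Qed.

Lemma exec_seq P Q ts ts1 ts2 t1 t2 :
  exec P ts ts1 t1 -> exec Q ts1 ts2 t2 ->
  exec (CSeq P Q) ts ts2 (t1 + t2).+1.
Proof.
move=> [q [n [le st /cstep_None hq]]] [q' [n' [le' st' /cstep_None hq']]].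
exists (inr q'), (n + (1 + n')); split; last by rewrite /cstep /= hq'.
  by rewrite add1n addnS ltnS leq_add.
apply: steps_trans.
  by apply: (@steps_embed P (CSeq P Q) inl) st => p s p' b /= ->.
apply: (@steps_trans (CSeq P Q) _ (inr (cstart Q))).
  by apply: steps1; rewrite /cstep /= hq acts_idle.
by apply: (@steps_embed Q (CSeq P Q) inr) st' => p s p' b /= ->.
Qed.

Lemma exec_if test P Q ts ts' t :
  exec (if test (scans ts) then P else Q) ts ts' t ->
  exec (CIf test P Q) ts ts' t.+1.
Proof.
have first c : test (scans ts) = c -> @steps (CIf test P Q) None ts 1
    (Some (if c then inl (cstart P) else inr (cstart Q))) ts.
  by move=> h; apply: steps1; rewrite /cstep /= h acts_idle.
case E: (test _) => -[q [n [le st /cstep_None hq]]].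
- exists (Some (inl q)), (1 + n); split=> //; last by rewrite /cstep /= hq.
  apply: steps_trans (first _ E) _.
  by apply: (@steps_embed P (CIf test P Q) (Some \o inl)) st => p s p' b /= ->.
- exists (Some (inr q)), (1 + n); split=> //; last by rewrite /cstep /= hq.
  apply: steps_trans (first _ E) _.
  by apply: (@steps_embed Q (CIf test P Q) (Some \o inr)) st => p s p' b /= ->.
Qed.

(** [f m] is the configuration after [m] rounds; the two extra steps of a round enter and leave the
    body. The induction is on the number of rounds still to come. *)
Lemma exec_while (test : symbols -> bool) P (f : nat -> tapes) N t :
  (forall m, m < N -> test (scans (f m)) /\ exec P (f m) (f m.+1) t) ->
  test (scans (f N)) = false ->
  exec (CWhile test P) (f 0) (f N) (N * t.+2).
Proof.
move=> hb he.
suff H j : j <= N -> exists n, n <= j * t.+2 /\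
    @steps (CWhile test P) None (f (N - j)) n None (f N).
  have [n [le st]] := H N (leqnn N); rewrite subnn in st.
  by exists None, n; split=> //; rewrite /cstep /= he.
elim: j => [|j IH] lej; first by exists 0; rewrite subn0; split=> //; constructor.
have [n [le st]] := IH (ltnW lej).
have lt : N - j.+1 < N by rewrite ltn_subrL; case: (N) lej.
have [ht [q [n' [le' st' /cstep_None hq]]]] := hb _ lt.
have E : (N - j.+1).+1 = N - j by rewrite subnSK.
rewrite E in st' hq.
exists (1 + (n' + (1 + n))); split.
  by rewrite mulSn add1n add1n addnS !addSn !ltnS leq_add.
apply: (@steps_trans (CWhile test P) _ (Some (cstart P))).
  by apply: steps1; rewrite /cstep /= ht acts_idle.
apply: (@steps_trans (CWhile test P) _ (Some q)).
  by apply: (@steps_embed P (CWhile test P) Some) st' => p s p' b /= ->.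
by apply: steps_trans st; apply: steps1; rewrite /cstep /= hq acts_idle.
Qed.

End Control.

(** * A language of nested loops over the input *)

(* Variables are de Bruijn levels: the loop variable of a For at depth d is
   number d. *)
Inductive prog :=
| Skip
| Out of bool
| Seq of prog & prog
| For of prog
| IfBit of nat & prog & prog
| IfLt of nat & nat & prog & prog.

Section Semantics.
Variable w : seq bool.
Let n := size w.

Fixpoint den (p : prog) (e : seq nat) : seq bool :=
  match p with
  | Skip => [::]
  | Out b => [:: b]
  | Seq p q => den p e ++ den q e
  | For p => flatten [seq den p (rcons e v) | v <- iota 0 n]
  | IfBit i p q => if nth false w (nth 0 e i) then den p e else den q e
  | IfLt i j p q => if nth 0 e i < nth 0 e j then den p e else den q e
  end.

End Semantics.

Fixpoint fits (D d : nat) (p : prog) : bool :=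
  match p with
  | Skip | Out _ => true
  | Seq p q => fits D d p && fits D d q
  | For p => (d < D) && fits D d.+1 p
  | IfBit i p q => [&& i < d, fits D d p & fits D d q]
  | IfLt i j p q => [&& i < d, j < d, fits D d p & fits D d q]
  end.

Fixpoint depth (p : prog) : nat :=
  match p with
  | Skip | Out _ => 0
  | Seq p q | IfBit _ p q | IfLt _ _ p q => maxn (depth p) (depth q)
  | For p => (depth p).+1
  end.

Fixpoint scoped (d : nat) (p : prog) : bool :=
  match p with
  | Skip | Out _ => true
  | Seq p q => scoped d p && scoped d q
  | For p => scoped d.+1 p
  | IfBit i p q => [&& i < d, scoped d p & scoped d q]
  | IfLt i j p q => [&& i < d, j < d, scoped d p & scoped d q]
  end.

Lemma fits_depth D d p : scoped d p -> d + depth p <= D -> fits D d p.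
Proof.
elim: p d => //= [p IHp q IHq|p IH|i p IHp q IHq|i j p IHp q IHq] d.
- by case/andP=> hp hq le; rewrite IHp ?IHq //; lia.
- by move=> hp le; rewrite IH //; lia.
- by case/and3P=> -> hp hq le; rewrite IHp ?IHq //; lia.
- by case/and4P=> -> -> hp hq le; rewrite IHp ?IHq //; lia.
Qed.

(** The constants are generous. The linear term of [IfLt] pays for walking two heads to the left end
    and back, that of [For] also for rewinding the loop variable. *)
Fixpoint time (p : prog) (n : nat) : nat :=
  match p with
  | Skip | Out _ => 1
  | Seq p q => (time p n + time q n).+1
  | For p => n * (time p n + 10) + n * 10 + 20
  | IfBit _ p q => (time p n + time q n).+1
  | IfLt _ _ p q => time p n + time q n + n * 20 + 20
  end.

(** * Compilation of loop programs to multi-tape machines *)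

Section Compile.
Variable D : nat.
(* Tape 0 is the output, tape 1 a scratch copy of the input, and tape d.+2 the
   copy of the input whose head is the loop variable d. *)
Notation k := D.+1.

Definition shift (f : nat -> move) : control k :=
  CAct (fun s : symbols k => [ffun i : 'I_k.+1 => (s i, f i)]).

Definition only (i : nat) (m : move) (j : nat) : move := if j == i then m else Stay.

Definition nonblank (i : nat) (s : symbols k) : bool := s (inord i) != None.

Definition write (b : bool) : control k :=
  CAct (fun s : symbols k => [ffun i : 'I_k.+1 =>
    if i == 0 :> nat then (Some b, MoveRight) else (s i, Stay)]).

(* Comparing i and j: both heads walk left in step until one of them leaves
   the input, while the scratch head counts the moves to be undone. *)
Definition lt_move (i j : nat) (m m' : move) (a : nat) : move :=
  if a == 1 then m' else if (a == i.+2) || (a == j.+2) then m else Stay.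

Fixpoint compile (d : nat) (p : prog) : control k :=
  match p with
  | Skip => shift (fun=> Stay)
  | Out b => write b
  | Seq p q => CSeq (compile d p) (compile d q)
  | For p =>
      CSeq (CWhile (nonblank d.+2)
             (CSeq (compile d.+1 p) (shift (only d.+2 MoveRight))))
      (CSeq (shift (only d.+2 MoveLeft))
      (CSeq (CWhile (nonblank d.+2) (shift (only d.+2 MoveLeft)))
            (shift (only d.+2 MoveRight))))
  | IfBit i p q =>
      CIf (fun s => s (inord i.+2) == Some true) (compile d p) (compile d q)
  | IfLt i j p q =>
      let restore := CWhile (nonblank 1) (shift (lt_move i j MoveRight MoveLeft)) in
      CSeq (CWhile (fun s => nonblank i.+2 s && nonblank j.+2 s)
             (shift (lt_move i j MoveLeft MoveRight)))
      (CIf (nonblank j.+2) (CSeq restore (compile d p))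
                           (CSeq restore (compile d q)))
  end.

Variable w : seq bool.
Let n := size w.

(* A blank on each side bounds every head movement, so that tapes are
   equal and not just equal up to trailing blanks. *)
Definition cells : seq cell := None :: rcons (map Some w) None.

Lemma size_cells : size cells = n.+2.
Proof. by rewrite /= size_rcons size_map. Qed.

Definition tape_at (h : nat) : tape :=
  (rev (take h cells), nth None cells h, drop h.+1 cells).

Lemma nth_cells v : nth None cells v.+1 =
  if v < n then Some (nth false w v) else None.
Proof.
rewrite /= nth_rcons size_map; case: ltnP => h; first by rewrite (nth_map false).
by case: eqP.
Qed.

Lemma nth_cells_blank v : v <= n.+1 ->
  (nth None cells v != None) = (0 < v <= n).
Proof. by case: v => // v _; rewrite nth_cells; case: ltnP. Qed.

Lemma tape_at_right h : h < n.+1 ->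
  act (tape_at h) (scan (tape_at h), MoveRight) = tape_at h.+1.
Proof.
move=> lt; have lt' : h.+1 < size cells by rewrite size_cells.
rewrite /act /scan /tape_at.
rewrite [in RHS](take_nth None) ?rev_rcons ?(ltnW lt') //.
by rewrite [(_, MoveRight).1]/= (drop_nth None lt').
Qed.

Lemma tape_at_left h : h < n.+1 ->
  act (tape_at h.+1) (scan (tape_at h.+1), MoveLeft) = tape_at h.
Proof.
move=> lt; have lt' : h.+1 < size cells by rewrite size_cells.
rewrite /act /scan /tape_at.
rewrite [in LHS](take_nth None) ?rev_rcons ?(ltnW lt') //.
by rewrite [(_, MoveLeft).1]/= -(drop_nth None lt').
Qed.

(** The [n] blanks on the left are the input, which is erased while it is copied to the other
    tapes. *)
Definition out_tape (o : seq bool) : tape :=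
  (rev (map Some o) ++ nseq n None, None, [::]).

Definition conf (o : seq bool) (pos : nat -> nat) : tapes k :=
  [ffun i : 'I_k.+1 => if i == 0 :> nat then out_tape o else tape_at (pos i)].

Lemma conf_ext o pos pos' :
  (forall i, 0 < i <= k -> pos i = pos' i) -> conf o pos = conf o pos'.
Proof.
move=> h; apply/ffunP=> i; rewrite !ffunE; case: eqP => // /eqP i0.
by rewrite h // lt0n i0 -ltnS ltn_ord.
Qed.

Lemma scans_conf o pos i : 0 < i <= k ->
  scans (conf o pos) (inord i) = nth None cells (pos i).
Proof.
case/andP=> i0 ik; rewrite !ffunE inordK // ifN //; by case: i i0 {ik}.
Qed.

Lemma nonblank_conf o pos i : 0 < i <= k -> pos i <= n.+1 ->
  nonblank i (scans (conf o pos)) = (0 < pos i <= n).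
Proof. by move=> ik le; rewrite /nonblank scans_conf // nth_cells_blank. Qed.

Lemma exec_shift o pos pos' f : f 0 = Stay ->
  (forall i, 0 < i <= k ->
    [\/ f i = Stay /\ pos' i = pos i,
        [/\ f i = MoveRight, pos' i = (pos i).+1 & pos i < n.+1] |
        [/\ f i = MoveLeft, pos i = (pos' i).+1 & pos i <= n.+1]]) ->
  exec (shift f) (conf o pos) (conf o pos') 1.
Proof.
move=> f0 h; suff -> : conf o pos' =
  acts (conf o pos) [ffun i : 'I_k.+1 => (scans (conf o pos) i, f i)].
  exact: exec_act.
apply/ffunP=> i; rewrite !ffunE.
case: eqP => [->|/eqP i0]; first by rewrite f0.
have /h : 0 < i <= k by rewrite lt0n i0 -ltnS ltn_ord.
case=> [[-> ->]|[-> -> lt]|[-> E lt]] //; first by rewrite tape_at_right.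
by rewrite E tape_at_left // -ltnS -E.
Qed.

Lemma exec_write o pos b :
  exec (write b) (conf o pos) (conf (rcons o b) pos) 1.
Proof.
suff -> : conf (rcons o b) pos = acts (conf o pos)
    [ffun i : 'I_k.+1 => if i == 0 :> nat then (Some b, MoveRight)
                         else (scans (conf o pos) i, Stay)] by exact: exec_act.
apply/ffunP=> i; rewrite !ffunE; case: eqP => // _.
by rewrite /out_tape map_rcons rev_rcons.
Qed.

(** Position 0 is the left blank, so letter [v] is at [v.+1]. The scratch head rests on the blank, a
    counter at zero. A variable that is not yet bound takes the default 0 of [nth] and hence already
    stands on the first letter, where its loop starts. *)
Definition env_pos (e : seq nat) (a : nat) : nat :=
  if a == 1 then 0 else (nth 0 e a.-2).+1.

Lemma env_pos_rcons e v a : 1 < a -> a != (size e).+2 ->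
  env_pos (rcons e v) a = env_pos e a.
Proof.
move=> a1 ane; rewrite /env_pos; case: eqP => // _; congr _.+1.
rewrite nth_rcons; case: ltnP => // le; case: eqP => [E|_]; first lia.
by rewrite nth_default.
Qed.

Lemma env_pos_last e v : env_pos (rcons e v) (size e).+2 = v.+1.
Proof. by rewrite /env_pos /= nth_rcons ltnn eqxx. Qed.

Lemma exec_for_exit o e : size e < D ->
  exec (CSeq (shift (only (size e).+2 MoveLeft))
       (CSeq (CWhile (nonblank (size e).+2) (shift (only (size e).+2 MoveLeft)))
             (shift (only (size e).+2 MoveRight))))
    (conf o (env_pos (rcons e n))) (conf o (env_pos e)) (n * 3 + 4).
Proof.
move=> lt; set d := size e.
pose g v a := if a == d.+2 then v else env_pos e a.
have dk : 0 < d.+2 <= k by rewrite ltnS; lia.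
apply: (@exec_le _ _ _ _ (1 + (n * 3 + 1).+1).+1); first lia.
apply: (@exec_seq _ _ _ _ (conf o (g n))).
  apply: exec_shift => // i ik; rewrite /only /g; case: eqP => [->|ne].
    by apply: Or33; rewrite env_pos_last.
  apply: Or31; split=> //; have [->//|i1] := eqVneq i 1.
  by rewrite env_pos_rcons //; last (by apply/eqP); lia.
apply: (@exec_seq _ _ _ _ (conf o (g 0))).
  have := @exec_while k (nonblank d.+2) (shift (only d.+2 MoveLeft))
            (fun v => conf o (g (n - v))) n 1.
  rewrite subn0 subnn; apply=> [m lm|]; last first.
    by rewrite nonblank_conf // /g eqxx.
  split; first by rewrite nonblank_conf // /g eqxx; lia.
  apply: exec_shift => // i ik; rewrite /only /g; case: eqP => [_|ne].
    by apply: Or33; split=> //; lia.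
  by apply: Or31.
apply: exec_shift => // i ik; rewrite /only /g; case: eqP => [->|ne].
  by apply: Or32; rewrite /env_pos /= nth_default.
by apply: Or31.
Qed.

Lemma exec_lt o e i j ts t P Q : let b := nth 0 e i < nth 0 e j in
  i < size e -> j < size e -> size e <= D -> all (fun v => v < n) e ->
  exec (if b then P else Q) (conf o (env_pos e)) ts t ->
  let restore := CWhile (nonblank 1) (shift (lt_move i j MoveRight MoveLeft)) in
  exec (CSeq (CWhile (fun s => nonblank i.+2 s && nonblank j.+2 s)
             (shift (lt_move i j MoveLeft MoveRight)))
      (CIf (nonblank j.+2) (CSeq restore P) (CSeq restore Q)))
    (conf o (env_pos e)) ts (t + n * 20 + 20).
Proof.
move=> b li lj hD he hx restore.
have vi : nth 0 e i < n := allP he _ (mem_nth 0 li).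
have vj : nth 0 e j < n := allP he _ (mem_nth 0 lj).
(* The heads start at the values plus one, so the first of them reaches the left blank after exactly
   [N] moves; head [j] is then still on a letter iff its value is the larger one. *)
pose N := (minn (nth 0 e i) (nth 0 e j)).+1.
pose g s a := if a == 1 then s else
  if (a == i.+2) || (a == j.+2) then env_pos e a - s else env_pos e a.
have g0 : conf o (env_pos e) = conf o (g 0).
  apply: conf_ext => a _; rewrite /g subn0.
  by have [->|_] := eqVneq a 1; last case: ifP.
have gi s : g s i.+2 = (nth 0 e i).+1 - s by rewrite /g /= eqxx.
have gj s : g s j.+2 = (nth 0 e j).+1 - s by rewrite /g /= eqxx orbT.
have ik : 0 < i.+2 <= k by rewrite ltnS; lia.
have jk : 0 < j.+2 <= k by rewrite ltnS; lia.
have ge s a : (a == i.+2) || (a == j.+2) -> s <= N ->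
    [/\ g s a = env_pos e a - s, s <= env_pos e a & env_pos e a <= n].
  move=> ha ls; rewrite /g ha; case/orP: ha => /eqP -> /=; rewrite /env_pos /=;
    by split=> //; lia.
have down s : s < N ->
    exec (shift (lt_move i j MoveLeft MoveRight)) (conf o (g s)) (conf o (g s.+1)) 1.
  move=> ls; apply: exec_shift => // a ak; rewrite /lt_move.
  have [->|a1] := eqVneq a 1; first by apply: Or32; split=> //; rewrite /g /=; lia.
  case: ifP => ha; last by apply: Or31; rewrite /g ha (negbTE a1).
  have [-> _ _] := ge _ _ ha (ltnW ls); have [-> h1 h2] := ge _ _ ha ls.
  by apply: Or33; split=> //; lia.
have up s : s < N ->
    exec (shift (lt_move i j MoveRight MoveLeft)) (conf o (g s.+1)) (conf o (g s)) 1.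
  move=> ls; apply: exec_shift => // a ak; rewrite /lt_move.
  have [->|a1] := eqVneq a 1; first by apply: Or33; split=> //; rewrite /g /=; lia.
  case: ifP => ha; last by apply: Or31; rewrite /g ha (negbTE a1).
  have [-> _ _] := ge _ _ ha (ltnW ls); have [-> h1 h2] := ge _ _ ha ls.
  by apply: Or32; split=> //; lia.
(* The scratch head, [N] cells from its blank, is still on a letter, so the way back takes exactly
   [N] rounds. *)
have hN : N <= n by rewrite /N; lia.
have hrestore : exec restore (conf o (g N)) (conf o (g 0)) (N * 3).
  have := @exec_while k (nonblank 1) (shift (lt_move i j MoveRight MoveLeft))
            (fun s => conf o (g (N - s))) N 1.
  rewrite subn0 subnn; apply=> [s ls|]; last by rewrite nonblank_conf.
  split; first by rewrite nonblank_conf // /g /=; lia.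
  by rewrite -(subnSK ls); apply: up; lia.
apply: (@exec_le _ _ _ _ (N * 3 + (N * 3 + t).+2).+1); first lia.
rewrite g0; apply: (@exec_seq _ _ _ _ (conf o (g N))).
  apply: (@exec_while _ _ _ (fun s => conf o (g s))) => [s ls|].
    split; last exact: down.
    by rewrite !nonblank_conf // ?gi ?gj /N; lia.
  by rewrite !nonblank_conf // ?gi ?gj /N; lia.
apply: exec_if; rewrite nonblank_conf // gj; last by lia.
rewrite [_ && _](_ : _ = b); last by rewrite /N /b; lia.
by case: (b) hx => hx; apply: exec_seq hrestore _; rewrite -g0.
Qed.

Lemma exec_compile p e o : fits D (size e) p -> all (fun v => v < n) e ->
  size e <= D ->
  exec (compile (size e) p) (conf o (env_pos e))
    (conf (o ++ den w p e) (env_pos e)) (time p n).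
Proof.
elim: p e o => /= [|b|p IHp q IHq|p IH|i p IHp q IHq|i j p IHp q IHq] e o.
- by move=> *; rewrite cats0; apply: exec_shift => // i _; apply: Or31.
- by move=> *; rewrite cats1; apply: exec_write.
- case/andP=> hp hq he hD; rewrite catA; apply: exec_seq; first exact: IHp.
  exact: IHq.
- case/andP=> lt hp he hD; set d := size e.
  (* The configuration at the beginning of round [v]; the value [n], past the last letter, is
     reached only on leaving the loop. *)
  pose f v := conf (o ++ flatten [seq den w p (rcons e v) | v <- iota 0 v])
               (env_pos (rcons e v)).
  have dk : 0 < d.+2 <= k by rewrite ltnS; lia.
  apply: (@exec_le _ _ _ _ (n * ((time p n + 1).+3) + (n * 3 + 4)).+1); first lia.
  apply: exec_seq (exec_for_exit _ lt).
  have -> : conf o (env_pos e) = f 0.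
    rewrite /f /= cats0; apply: conf_ext => a ak.
    have [->|ad] := eqVneq a d.+2.
      by rewrite env_pos_last /env_pos /= nth_default.
    have [->//|a1] := eqVneq a 1.
    by rewrite env_pos_rcons //; lia.
  apply: exec_while => [v lv|]; last first.
    by rewrite nonblank_conf // env_pos_last // ltnn.
  split; first by rewrite nonblank_conf // env_pos_last //; lia.
  apply: exec_seq.
    have := IH (rcons e v) (o ++ flatten [seq den w p (rcons e v) | v <- iota 0 v]).
    rewrite size_rcons; apply=> //.
    by rewrite all_rcons lv.
  rewrite /f -catA -[v.+1]addn1 iotaD map_cat flatten_cat /= cats0 addn1.
  apply: exec_shift => // i ik; rewrite /only; case: eqP => [->|/eqP ne].
    by apply: Or32; rewrite !env_pos_last; split=> //; lia.
  apply: Or31; split=> //; have [->//|i1] := eqVneq i 1.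
  by rewrite !env_pos_rcons //; lia.
- case/and3P=> lt hp hq he hD; apply: exec_if.
  have iD : 0 < i.+2 <= k by rewrite ltnS; lia.
  have lv : nth 0 e i < n := allP he _ (mem_nth 0 lt).
  rewrite scans_conf // nth_cells /= lv.
  rewrite [_ == _](_ : _ = nth false w (nth 0 e i)); last by case: (nth false w _).
  case: (nth false w _).
    by apply: exec_le (IHp _ _ hp he hD); apply: leq_addr.
  by apply: exec_le (IHq _ _ hq he hD); apply: leq_addl.
- case/and4P=> li lj hp hq he hD; apply: exec_lt => //.
  case: ifP => _.
    by apply: exec_le (IHp _ _ hp he hD); apply: leq_addr.
  by apply: exec_le (IHq _ _ hq he hD); apply: leq_addl.
Qed.

End Compile.
Arguments shift {D} f.

(** The output head is finally walked back over the whole output, so the length of the output enters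
    the running time. *)
Lemma size_den w p e : size (den w p e) <= time p (size w).
Proof.
elim: p e => //= [p IHp q IHq|p IH|i p IHp q IHq|i j p IHp q IHq] e.
- by rewrite size_cat; move: (IHp e) (IHq e); lia.
- apply: (@leq_trans (size w * time p (size w))); last by lia.
  rewrite -[X in _ <= X * _](size_iota 0).
  elim: (iota _ _) => //= v s IHs.
  by rewrite size_cat mulSn leq_add.
- by case: ifP => _; [move: (IHp e)|move: (IHq e)]; lia.
- by case: ifP => _; [move: (IHp e)|move: (IHq e)]; lia.
Qed.

(** * Polynomial bounds *)

Definition poly_bounded (f : nat -> nat) : Prop :=
  exists P : {poly nat}, forall n, f n <= P.[n]%R.

Lemma poly_bounded_const c : poly_bounded (fun=> c).
Proof. by exists (c%:P)%R => n; rewrite hornerC. Qed.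

Lemma poly_bounded_id : poly_bounded id.
Proof. by exists 'X%R => n; rewrite hornerX. Qed.

Lemma poly_bounded_add f g : poly_bounded f -> poly_bounded g ->
  poly_bounded (fun n => f n + g n).
Proof.
by move=> [P hP] [Q hQ]; exists (P + Q)%R => n; rewrite hornerD leq_add.
Qed.

Lemma poly_bounded_mul f g : poly_bounded f -> poly_bounded g ->
  poly_bounded (fun n => f n * g n).
Proof.
by move=> [P hP] [Q hQ]; exists (P * Q)%R => n; rewrite hornerM leq_mul.
Qed.

Lemma poly_bounded_time p : poly_bounded (time p).
Proof.
have [A [M [I C]]] := (poly_bounded_add, (poly_bounded_mul,
  (poly_bounded_id, poly_bounded_const))).
have S f : poly_bounded f -> poly_bounded (fun n => (f n).+1) := A _ _ (C 1).
elim: p => /= [|b|p IHp q IHq|p IH|i p IHp q IHq|i j p IHp q IHq].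
- exact: C.
- exact: C.
- by apply/S/A.
- exact: A _ _ (A _ _ (M _ _ I (A _ _ IH (C 10))) (M _ _ I (C 10))) (C 20).
- by apply/S/A.
- exact: A _ _ (A _ _ (A _ _ IHp IHq) (M _ _ I (C 20))) (C 20).
Qed.

(** * Copying the input to the working tapes and rewinding the output *)

Section Frame.
Variable D : nat.
Notation k := D.+1.

Definition enter : control k :=
  CAct (fun s : symbols k => [ffun i : 'I_k.+1 =>
    if i == 0 :> nat then (s i, Stay) else (None, MoveRight)]).

Definition copy : control k :=
  CAct (fun s : symbols k => [ffun i : 'I_k.+1 =>
    (if i == 0 :> nat then None else s ord0, MoveRight)]).

Definition others (m : move) (a : nat) : move := if a == 0 then Stay else m.
Definition vars (m : move) (a : nat) : move := if a <= 1 then Stay else m.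

Definition setup : control k :=
  CSeq enter (CSeq (CWhile (fun s => s ord0 != None) copy)
    (CSeq (shift (others MoveLeft))
    (CSeq (CWhile (nonblank 1) (shift (others MoveLeft)))
          (shift (vars MoveRight))))).

Definition finish : control k :=
  CSeq (shift (only 0 MoveLeft))
  (CSeq (CWhile (fun s => s ord0 != None) (shift (only 0 MoveLeft)))
        (shift (only 0 MoveRight))).

Variable w : seq bool.
Let n := size w.

Lemma exec_setup :
  exec setup [ffun i => load (if i == ord0 then w else [::])]
    (conf D w [::] (env_pos [::])) (n * 6 + 20).
Proof.
pose sw := map Some w.
(* After [j] rounds tape 0 has lost its first [j] letters, and every other tape holds them behind
   the blank written by [enter]. *)
pose C j : tapes k := [ffun i : 'I_k.+1 => if i == 0 :> nat
  then (nseq j None, head None (drop j sw), behead (drop j sw))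
  else (rev (None :: map Some (take j w)), None, [::])].
have Cn : C n = conf D w [::] (fun=> n.+1).
  apply/ffunP=> i; rewrite !ffunE; case: eqP => // _.
    by rewrite drop_oversize // size_map.
  rewrite take_size /tape_at nth_cells ltnn drop_oversize ?size_cells //.
  by rewrite /= -cats1 take_cat size_map ltnn subnn cats0.
apply: (@exec_le _ _ _ _ (1 + (n * 3 + (1 + (n * 3 + 1).+1).+1).+1).+1); first lia.
apply: (@exec_seq _ _ _ _ (C 0)).
  have -> : C 0 = acts [ffun i => load (if i == ord0 then w else [::])]
     [ffun i : 'I_k.+1 => if i == 0 :> nat
      then (scans [ffun i => load (if i == ord0 then w else [::])] i, Stay)
      else (None, MoveRight)].
    apply/ffunP=> i; rewrite !ffunE.
    have -> : (i == 0 :> nat) = (i == ord0) by [].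
    by case: (i == ord0); rewrite /= ?drop0 ?take0.
  exact: exec_act.
apply: (@exec_seq _ _ _ _ (C n)).
  apply: exec_while => [j lj|]; last first.
    by rewrite !ffunE /= drop_oversize // size_map.
  have ljs : j < size sw by rewrite size_map.
  split; first by rewrite !ffunE /scan /= -nth0 nth_drop addn0 (nth_map false).
  suff -> : C j.+1 = acts (C j) [ffun i : 'I_k.+1 =>
       (if i == 0 :> nat then None else scans (C j) ord0, MoveRight)].
    exact: exec_act.
  apply/ffunP=> i; rewrite !ffunE; case: eqP => // _ /=.
    by rewrite (drop_nth None ljs).
  rewrite /scan /= (take_nth false) // map_rcons !rev_cons rev_rcons.
  by rewrite -nth0 nth_drop addn0 (nth_map false).
rewrite Cn.
apply: (@exec_seq _ _ _ _ (conf D w [::] (fun=> n))).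
  apply: exec_shift => // i /andP[i0 _]; rewrite /others.
  by apply: Or33; case: i i0.
apply: (@exec_seq _ _ _ _ (conf D w [::] (fun=> 0))).
  have := @exec_while k (nonblank 1) (shift (others MoveLeft))
            (fun s => conf D w [::] (fun=> n - s)) n 1.
  rewrite subn0 subnn; apply=> [s ls|]; last by rewrite nonblank_conf.
  split; first by rewrite nonblank_conf //; lia.
  apply: exec_shift => // i /andP[i0 _]; rewrite /others.
  by apply: Or33; case: i i0 => // i _; split=> //; lia.
apply: exec_shift => // i /andP[i0 _]; rewrite /vars /env_pos.
case: i i0 => [|[|i]] // _; first by apply: Or31.
by apply: Or32; rewrite /= nth_nil.
Qed.

Lemma exec_finish o pos : exists2 ts,
  exec finish (conf D w o pos) ts (size o * 3 + 10) & contents (ts ord0) = o.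
Proof.
pose so := map Some o.
pose L j := rev (take j so) ++ nseq n None.
pose F j : tapes k := [ffun i : 'I_k.+1 => if i == 0 :> nat
  then (behead (L j), head None (L j), drop j so ++ [:: None])
  else tape_at w (pos i)].
(* [None :: behead (L 0)] differs from [L 0] only for empty input, where the head steps off the left
   end of the list and thereby adds a blank to it. *)
pose E : tapes k := [ffun i : 'I_k.+1 => if i == 0 :> nat
  then (None :: behead (L 0), head None (so ++ [:: None]), behead (so ++ [:: None]))
  else tape_at w (pos i)].
have stay (t : tape) : act t (scan t, Stay) = t by case: t => [[]].
have exec_only (ts ts' : tapes k) (m : move) :
    (forall i : 'I_k.+1, ts' i = if i == 0 :> nat then act (ts i) (scan (ts i), m)
                         else ts i) ->
    exec (shift (only 0 m)) ts ts' 1.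
  move=> h; suff -> : ts' =
      acts ts [ffun i : 'I_k.+1 => (scans ts i, only 0 m i)] by exact: exec_act.
  apply/ffunP=> i; rewrite h !ffunE /only; case: eqP => // _.
exists E; last first.
  rewrite ffunE /= /contents /= /so.
  by elim: (o) => //= b s; case: s => //= b' s' ->.
apply: (@exec_le _ _ _ _ (1 + (size o * 3 + 1).+1).+1); first lia.
apply: (@exec_seq _ _ _ _ (F (size o))).
  apply: exec_only => i; rewrite !ffunE; case: eqP => // _.
  by rewrite /L take_oversize ?drop_oversize ?size_map.
apply: (@exec_seq _ _ _ _ (F 0)).
  have := @exec_while k (fun s => s ord0 != None) (shift (only 0 MoveLeft))
            (fun j => F (size o - j)) (size o) 1.
  rewrite subn0 subnn; apply=> [j lj|]; last first.
    by rewrite !ffunE /= /scan /L /= take0; case: (n).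
  have lt : size o - j.+1 < size so by rewrite size_map; lia.
  have LE : L (size o - j) = nth None so (size o - j.+1) :: L (size o - j.+1).
    by rewrite -(subnSK lj) /L (take_nth None lt) rev_rcons.
  split.
    by rewrite !ffunE /scan /= LE /= /so (nth_map false) //; move: lt; rewrite size_map.
  apply: exec_only => i; rewrite !ffunE; case: eqP => // _.
  by rewrite /scan /act LE /= (drop_nth None lt) subnSK.
apply: exec_only => i; rewrite !ffunE; case: eqP => // _.
by rewrite /scan /act /L drop0 take0 /=; case: (n).
Qed.

End Frame.

Lemma prog_poly_time p : scoped 0 p -> exists (M : machine) (P : {poly nat}),
  forall w, outputs M w P.[size w]%R (den w p [::]).
Proof.
move=> hp; pose D := depth p.
(* Set-up costs at most [n * 6 + 20], the program [time p n], and rewinding three steps per output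
   letter, of which there are at most [time p n]. *)
have [P hP] : poly_bounded (fun n => n * 6 + (time p n * 4 + 40)).
  have [A [M C]] := (poly_bounded_add, (poly_bounded_mul, poly_bounded_const)).
  exact: (A _ _ (M _ _ poly_bounded_id (C 6))
                (A _ _ (M _ _ (poly_bounded_time p) (C 4)) (C 40))).
exists (machine_of (CSeq (setup D) (CSeq (compile D 0 p) (finish D)))), P => w.
have fp : fits D 0 p by apply: fits_depth hp _.
have h1 := @exec_setup D w.
have h2 := @exec_compile D w p [::] [::] fp isT isT.
have [ts h3 hts] := @exec_finish D w (den w p [::]) (env_pos [::]).
have h := exec_seq h1 (exec_seq h2 h3).
have le : (size w * 6 + 20 + (time p (size w) + (size (den w p [::]) * 3 + 10)).+1).+1
    <= P.[size w]%R.
  by apply: leq_trans (hP (size w)); move: (size_den w p [::]); lia.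
exact: exec_outputs (exec_le le h) hts.
Qed.

(** * Printing the instances of clauses *)

Inductive expr :=
| Cst of nat
| Var of nat
| Len
| Add of expr & expr
| Mul of expr & expr.

Fixpoint eval (n : nat) (e : seq nat) (a : expr) : nat :=
  match a with
  | Cst c => c
  | Var i => nth 0 e i
  | Len => n
  | Add a b => eval n e a + eval n e b
  | Mul a b => eval n e a * eval n e b
  end.

Fixpoint expr_scoped (d : nat) (a : expr) : bool :=
  match a with
  | Cst _ | Len => true
  | Var i => i < d
  | Add a b | Mul a b => expr_scoped d a && expr_scoped d b
  end.

(* The repeated program is given as a function of the depth at which it ends
   up, since IfLt has to name the loop variable it introduces. *)
Fixpoint rep (a : expr) (d : nat) (p : nat -> prog) : prog :=
  match a with
  | Cst c => iter c (Seq (p d)) Skip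
  | Var i => For (IfLt d i (p d.+1) Skip)
  | Len => For (p d.+1)
  | Add a b => Seq (rep a d p) (rep b d p)
  | Mul a b => rep a d (fun d' => rep b d' p)
  end.

Definition unary (a : expr) (d : nat) : prog :=
  Seq (rep a d (fun=> Out true)) (Out false).

Definition plist (ps : seq prog) : prog :=
  foldr (fun p q => Seq (Seq (Out true) p) q) (Out false) ps.

Lemma expr_scoped_le d d' a : d <= d' -> expr_scoped d a -> expr_scoped d' a.
Proof.
move=> le; elim: a => //= [i|a IHa b IHb|a IHa b IHb].
- by move=> h; apply: leq_trans le.
- by case/andP=> /IHa -> /IHb.
- by case/andP=> /IHa -> /IHb.
Qed.

Lemma rep_scoped a d p : expr_scoped d a ->
  (forall d', d <= d' -> scoped d' (p d')) -> scoped d (rep a d p).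
Proof.
elim: a d p => /= [c|i||a IHa b IHb|a IHa b IHb] d p ha hp.
- by elim: c => //= c ->; rewrite hp.
- by rewrite ltnS leqnn hp //= ltnS ltnW.
- exact: hp.
- by case/andP: ha => ha hb; rewrite IHa ?IHb.
- case/andP: ha => ha hb; apply: IHa => // d' le; apply: IHb.
    exact: expr_scoped_le hb.
  by move=> d'' le'; apply: hp; apply: leq_trans le'.
Qed.

Lemma unary_scoped a d : expr_scoped d a -> scoped d (unary a d).
Proof. by move=> ha; rewrite /= rep_scoped. Qed.

Lemma plist_scoped d ps : scoped d (plist ps) = all (scoped d) ps.
Proof. by elim: ps => //= p ps ->. Qed.

Lemma iter_For_scoped k d p : scoped d (iter k For p) = scoped (k + d) p.
Proof. by elim: k d => //= k IH d; rewrite IH addnS. Qed.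

Section Denotation.
Variable w : seq bool.
Let n := size w.

Lemma den_Seq p q e : den w (Seq p q) e = den w p e ++ den w q e.
Proof. by []. Qed.

Lemma den_plist ps e :
  den w (plist ps) e = flatten [seq true :: den w p e | p <- ps] ++ [:: false].
Proof. by elim: ps => //= p ps ->; rewrite catA. Qed.

Lemma flatten_nseqD (T : Type) a b (o : seq T) :
  flatten (nseq (a + b) o) = flatten (nseq a o) ++ flatten (nseq b o).
Proof. by rewrite nseqD flatten_cat. Qed.

Lemma flatten_const (S T : Type) (f : S -> seq T) o s :
  (forall v, f v = o) -> flatten [seq f v | v <- s] = flatten (nseq (size s) o).
Proof. by move=> h; elim: s => //= v s ->; rewrite h. Qed.

(** [x] holds the counters of the loops that [rep] has already opened. The repeated output must not
    depend on them, and quantifying over [x] lets the inner loops of [Mul] use the induction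
    hypothesis. A bound [Var i] is realised by a loop over all [n] positions, which suffices as its
    value is below [n]. *)
Lemma den_rep a p e o : expr_scoped (size e) a -> all (fun v => v < n) e ->
  (forall x, den w (p (size (e ++ x))) (e ++ x) = o) ->
  forall x, den w (rep a (size (e ++ x)) p) (e ++ x)
            = flatten (nseq (eval n e a) o).
Proof.
move=> ha he; elim: a p o ha => [c|i||a IHa b IHb|a IHa b IHb] p o /= ha hp x.
- by elim: c => //= c ->; rewrite hp.
- have lt : nth 0 e i < n := allP he _ (mem_nth 0 ha).
  set d := size (e ++ x); set t := nth 0 e i.
  have step v : den w (IfLt d i (p d.+1) Skip) (rcons (e ++ x) v) =
      if v < t then o else [::].
    have hi : i < size (e ++ x) by rewrite size_cat ltn_addr.
    rewrite /= !nth_rcons hi ltnn eqxx nth_cat ha -/t.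
    by rewrite -(hp (rcons x v)) -rcons_cat size_rcons.
  rewrite (eq_map (g := fun v => if v < t then o else [::])); last exact: step.
  rewrite -/n -(subnKC (ltnW lt)) iotaD map_cat flatten_cat add0n.
  rewrite [X in _ ++ X](_ : _ = [::]); last first.
    suff H m s : t <= s ->
        flatten [seq if v < t then o else [::] | v <- iota s m] = [::] by exact: H.
    elim: m s => //= m IH s le.
    by rewrite ltnNge le /=; apply: IH; apply: leqW.
  rewrite cats0 -[in RHS](size_iota 0 t).
  have : all (fun v => v < t) (iota 0 t) by apply/allP=> v; rewrite mem_iota.
  by elim: (iota 0 t) => //= v s IH /andP[-> /IH ->].
- rewrite (flatten_const (o := o)) ?size_iota // => v.
  by rewrite -(hp (rcons x v)) -rcons_cat size_rcons.
- by case/andP: ha => ha hb; rewrite (IHa _ o) // (IHb _ o) // flatten_nseqD.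
- case/andP: ha => ha hb.
  rewrite (IHa _ (flatten (nseq (eval n e b) o)) ha); last first.
    by move=> y; apply: IHb.
  by elim: (eval n e a) => //= m ->; rewrite mulSn flatten_nseqD.
Qed.

Lemma den_unary a e : expr_scoped (size e) a -> all (fun v => v < n) e ->
  den w (unary a (size e)) e = code_unary (eval n e a).
Proof.
move=> ha he; rewrite /= /code_unary; congr (_ ++ _).
have := @den_rep a (fun=> Out true) e [:: true] ha he (fun=> erefl) [::].
by rewrite cats0 => ->; elim: (eval n e a) => //= m ->.
Qed.

Fixpoint envs (k : nat) : seq (seq nat) :=
  if k is k'.+1 then flatten [seq [seq v :: x | x <- envs k'] | v <- iota 0 n]
  else [:: [::]].

Lemma mem_envs k e : (e \in envs k) = (size e == k) && all (fun v => v < n) e.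
Proof.
elim: k e => [|k IH] e; first by case: e.
apply/flatten_mapP/idP => [[v hv /mapP[x hx ->]]|].
  rewrite /= eqSS; move: hx; rewrite IH => /andP[-> ->].
  by move: hv; rewrite mem_iota /= add0n => ->.
case: e => // v x /= /andP[hs /andP[hv hx]]; exists v.
  by rewrite mem_iota.
by apply: map_f; rewrite IH -eqSS hs.
Qed.

Lemma den_iter_For k p e :
  den w (iter k For p) e = flatten [seq den w p (e ++ x) | x <- envs k].
Proof.
elim: k e => [|k IH] e; first by rewrite /= !cats0.
rewrite [iter _ _ _]/= [den _ _ _]/= [envs _]/= -/n.
elim: (iota 0 n) => //= v s ->; rewrite map_cat flatten_cat IH.
congr (_ ++ _); rewrite -map_comp; congr flatten.
by apply: eq_map => x; rewrite /= cat_rcons.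
Qed.

End Denotation.

(** * Clauses and the grammar of their instances *)

Inductive term := At of nat | Rel of nat & nat.

Definition term_expr (t : term) : expr :=
  match t with At c => Cst c | Rel i c => Add (Cst c) (Var i) end.

Definition term_val (e : seq nat) (t : term) : nat :=
  match t with At c => c | Rel i c => c + nth 0 e i end.

Definition term_ok (k : nat) (t : term) : bool :=
  match t with At c => c < 5 | Rel i c => (i < k) && (c < 5) end.

Record atom := Atom { apred : nat; aarg1 : term; aarg2 : term }.

(* [None] stands for the terminal c.  The guard, if any, is on the bit at the
   position given by variable 0. *)
Record clause := Clause {
  cvars : nat;
  cguard : option bool;
  chead : atom;
  cbody : seq (option atom);
  crest : seq (seq (option atom))
}.

Definition atom_ok k (a : atom) : bool :=
  [&& apred a < 8, term_ok k (aarg1 a) & term_ok k (aarg2 a)].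

Definition sym_ok k (s : option atom) : bool :=
  if s is Some a then atom_ok k a else true.

Definition clause_ok (c : clause) : bool :=
  [&& (cguard c == None) || (0 < cvars c), atom_ok (cvars c) (chead c),
      all (sym_ok (cvars c)) (cbody c) & all (all (sym_ok (cvars c))) (crest c)].

Definition guard (w : seq bool) (c : clause) (e : seq nat) : bool :=
  if cguard c is Some b then nth false w (nth 0 e 0) == b else true.

(* All the coordinates that occur are below n + 5, by [term_val_lt]. *)
Definition slot (n P x y : nat) : nat := (x * (n + 5) + y) * 8 + P.

Definition slot_bound (n : nat) : nat := (n + 5) * (n + 5) * 8.

Lemma slot_lt n P x y : P < 8 -> x < n + 5 -> y < n + 5 ->
  slot n P x y < slot_bound n.
Proof. by rewrite /slot /slot_bound; nia. Qed.

Lemma slot_inj n P x y P' x' y' : P < 8 -> y < n + 5 -> P' < 8 -> y' < n + 5 ->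
  slot n P x y = slot n P' x' y' -> [/\ P = P', x = x' & y = y'].
Proof.
move=> hP hy hP' hy' E.
have E1 : P = P'.
  by move/(congr1 (modn^~ 8)): E; rewrite /slot !modnMDl !modn_small.
have E2 : x * (n + 5) + y = x' * (n + 5) + y'.
  by move/(congr1 (divn^~ 8)): E; rewrite /slot !divnMDl // !divn_small // !addn0.
have pos : 0 < n + 5 by rewrite addn_gt0 orbT.
split=> //.
  by move/(congr1 (divn^~ (n + 5))): E2; rewrite !divnMDl // !divn_small // !addn0.
by move/(congr1 (modn^~ (n + 5))): E2; rewrite !modnMDl !modn_small.
Qed.

Section Grammar.
Variable clauses : seq clause.
Variable w : seq bool.
Let n := size w.

(** Ordinals instead of triples: the rank of an ordinal is its value, so the code of a symbol is an
    arithmetic expression in unary. The successor makes [inord] available. *)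
Definition nterm := 'I_(slot_bound n).+1.

Definition nt (P x y : nat) : nterm := inord (slot n P x y).

Definition inst_atom (e : seq nat) (a : atom) : nterm :=
  nt (apred a) (term_val e (aarg1 a)) (term_val e (aarg2 a)).

Definition inst_sym (e : seq nat) (s : option atom) : nterm + unit :=
  if s is Some a then inl (inst_atom e a) else inr tt.

Definition inst (c : clause) (e : seq nat) : rule nterm unit :=
  (inst_atom e (chead c), map (inst_sym e) (cbody c),
   map (map (inst_sym e)) (crest c)).

Definition clause_rules (c : clause) : seq (rule nterm unit) :=
  [seq inst c e | e <- envs w (cvars c) & guard w c e].

Definition gram : unary_grammar :=
  UnaryGrammar (ConjGrammar (flatten [seq clause_rules c | c <- clauses])).

End Grammar.

Definition atom_expr (a : atom) : expr :=
  Add (Mul (Add (Mul (term_expr (aarg1 a)) (Add Len (Cst 5)))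
                (term_expr (aarg2 a))) (Cst 8)) (Cst (apred a)).

Definition psym (d : nat) (s : option atom) : prog :=
  if s is Some a then Seq (Out false) (unary (atom_expr a) d)
  else Seq (Out true) (Out false).

Definition prule (c : clause) : prog :=
  let d := cvars c in
  Seq (unary (atom_expr (chead c)) d)
      (plist [seq plist [seq psym d s | s <- b] | b <- cbody c :: crest c]).

Definition pguarded (c : clause) : prog :=
  let p := Seq (Out true) (prule c) in
  match cguard c with
  | None => p
  | Some true => IfBit 0 p Skip
  | Some false => IfBit 0 Skip p
  end.

Definition pclause (c : clause) : prog := iter (cvars c) For (pguarded c).

Definition pgram (clauses : seq clause) : prog :=
  Seq (unary (Add (Cst 1) (Mul (Mul (Add Len (Cst 5)) (Add Len (Cst 5))) (Cst 8))) 0)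
  (Seq (unary (Cst 1) 0)
       (foldr (fun c q => Seq (pclause c) q) (Out false) clauses)).

Lemma atom_expr_scoped k a : atom_ok k a -> expr_scoped k (atom_expr a).
Proof.
case: a => P x y /and3P[_ /= hx hy].
have h t : term_ok k t -> expr_scoped k (term_expr t).
  by case: t => //= i c /andP[->].
by rewrite !h.
Qed.

Lemma psym_scoped k s : sym_ok k s -> scoped k (psym k s).
Proof. by case: s => [a|] // /atom_expr_scoped h; exact (unary_scoped h). Qed.

Lemma pgram_scoped clauses : all clause_ok clauses -> scoped 0 (pgram clauses).
Proof.
rewrite /pgram /=; elim: clauses => //= c cs IH /andP[hc /IH ->]; rewrite andbT.
rewrite /pclause /pguarded iter_For_scoped addn0; case/and4P: hc => hg hh hb hr.
have hp : scoped (cvars c) (Seq (Out true) (prule c)).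
  have hbody b : all (sym_ok (cvars c)) b ->
      scoped (cvars c) (plist [seq psym (cvars c) s | s <- b]).
    by move=> h; rewrite plist_scoped all_map; apply: sub_all h; apply: psym_scoped.
  have hbodies : scoped (cvars c) (plist [seq plist [seq psym (cvars c) s | s <- b]
                                         | b <- cbody c :: crest c]).
    rewrite plist_scoped all_map; apply/andP; split; first exact (hbody _ hb).
    exact (sub_all hbody hr).
  by apply/andP; split=> //; apply/andP; split; first exact (unary_scoped (atom_expr_scoped hh)).
by case: (cguard c) hg => [[]|] // h; apply/and3P; split.
Qed.

(** * The printed word is the code of the grammar *)

Section Emission.
Variable w : seq bool.
Let n := size w.

Lemma code_unary_nt N (i : 'I_N) : code_unary (enum_rank i) = code_unary i.
Proof. by rewrite enum_rank_ord. Qed.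

Lemma term_val_lt k e t : term_ok k t -> size e = k ->
  all (fun v => v < n) e -> term_val e t < n + 5.
Proof.
case: t => /= [c h _ _|i c /andP[hi hc] he /allP ha].
  by apply: leq_trans h _; rewrite leq_addl.
have lt : nth 0 e i < n := ha _ (mem_nth 0 (leq_trans hi (eq_leq (esym he)))).
by rewrite addnC -addSn leq_add // ltnW.
Qed.

Lemma den_atom k e a : atom_ok k a -> size e = k -> all (fun v => v < n) e ->
  den w (unary (atom_expr a) k) e = code_unary (inst_atom w e a).
Proof.
move=> ha he hv; rewrite -[in LHS]he den_unary // ?he ?atom_expr_scoped //.
case/and3P: ha => hP hx hy.
rewrite /inst_atom /nt inordK; last first.
  by rewrite ltnS ltnW // slot_lt // (term_val_lt (k := k)).
by rewrite /slot /=; case: (aarg1 a) => *; case: (aarg2 a).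
Qed.

Lemma den_sym k e s : sym_ok k s -> size e = k -> all (fun v => v < n) e ->
  den w (psym k s) e = code_symbol (inst_sym w e s).
Proof.
case: s => [a|] ha he hv /=; last first.
  rewrite /code_unary.
  by have := leq_trans (ltn_ord (enum_rank tt)) (eq_leq card_unit); case: (nat_of_ord _).
by rewrite code_unary_nt -(den_atom ha he hv).
Qed.

Lemma den_body k e b : all (sym_ok k) b -> size e = k -> all (fun v => v < n) e ->
  den w (plist [seq psym k s | s <- b]) e
  = code_list (@code_symbol _ _) (map (inst_sym w e) b).
Proof.
move=> hb he hv; rewrite den_plist /code_list; congr (flatten _ ++ _).
rewrite -!map_comp; elim: b hb => //= s b IH /andP[hs hb].
by rewrite (den_sym hs he hv) IH.
Qed.

Lemma den_rule c e : clause_ok c -> e \in envs w (cvars c) ->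
  den w (prule c) e = code_rule (inst w c e).
Proof.
case/and4P=> _ hh hb hr; rewrite mem_envs => /andP[/eqP he hv].
rewrite /prule den_Seq (den_atom hh he hv) /code_rule code_unary_nt.
congr (_ ++ _); rewrite den_plist /code_list; congr (flatten _ ++ _).
rewrite /conjuncts /= (den_body hb he hv); congr (_ :: _).
rewrite -!map_comp; elim: (crest c) hr => //= b bs IH /andP[hb' hbs].
by rewrite (den_body hb' he hv) IH.
Qed.

Lemma den_guarded c e : clause_ok c -> e \in envs w (cvars c) ->
  den w (pguarded c) e
  = if guard w c e then true :: code_rule (inst w c e) else [::].
Proof.
move=> hc he.
have h : den w (Seq (Out true) (prule c)) e = true :: code_rule (inst w c e).
  by rewrite den_Seq den_rule.
rewrite /pguarded /guard; case: (cguard c) => [[]|]; last exact: h.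
- rewrite -[LHS]/(if nth false w (nth 0 e 0) then
    den w (Seq (Out true) (prule c)) e else [::]) h.
  by case: (nth false w _).
- rewrite -[LHS]/(if nth false w (nth 0 e 0) then [::] else
    den w (Seq (Out true) (prule c)) e) h.
  by case: (nth false w _).
Qed.

Lemma den_clause c : clause_ok c ->
  den w (pclause c) [::]
  = flatten [seq true :: code_rule r | r <- clause_rules w c].
Proof.
move=> hc; rewrite /pclause den_iter_For /clause_rules -map_comp.
rewrite [map _ _](_ : _ = [seq if guard w c e then true :: code_rule (inst w c e)
                            else [::] | e <- envs w (cvars c)]); last first.
  by apply/eq_in_map => e he; rewrite den_guarded.
by elim: (envs w (cvars c)) => //= e s ->; case: (guard w c e).
Qed.

Lemma den_gram clauses : all clause_ok clauses ->
  den w (pgram clauses) [::] = code_grammar (gram clauses w).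
Proof.
move=> hc; have u a : expr_scoped 0 a -> den w (unary a 0) [::] = code_unary (eval n [::] a).
  by move=> ha; apply: (@den_unary w a [::]).
rewrite /pgram den_Seq u // den_Seq u //.
rewrite /code_grammar card_ord card_unit; congr (_ ++ (_ ++ _)); rewrite /code_list.
elim: clauses hc => //= c cs IH /andP[hc hcs].
by rewrite IH // den_clause // map_cat flatten_cat -catA.
Qed.

End Emission.

(** * Derivability in the grammar of a list of clauses *)

Scheme derives_mut := Induction for derives Sort Prop
  with derives_seq_mut := Induction for derives_seq Sort Prop.

Section Clauses.
Variable clauses : seq clause.
Hypothesis clauses_ok : all clause_ok clauses.
Variable w : seq bool.
Let n := size w.
Let G := gram clauses w.

(* D P x y m stands for a property of the word c^m. *)
Fixpoint holds_seq (D : nat -> nat -> nat -> nat -> Prop) (e : seq nat)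
    (b : seq (option atom)) (m : nat) : Prop :=
  match b with
  | [::] => m = 0
  | Some (Atom P x y) :: b => exists m1 m2,
      [/\ m = m1 + m2, D P (term_val e x) (term_val e y) m1 & holds_seq D e b m2]
  | None :: b => exists2 m', m = m'.+1 & holds_seq D e b m'
  end.

Definition derivable (P x y m : nat) : Prop :=
  language G (inl (nt w P x y)) (nseq m tt).

Lemma nt_inj P x y P' x' y' : P < 8 -> x < n + 5 -> y < n + 5 ->
  P' < 8 -> x' < n + 5 -> y' < n + 5 -> nt w P x y = nt w P' x' y' ->
  [/\ P = P', x = x' & y = y'].
Proof.
have val_nt Q a b : Q < 8 -> a < n + 5 -> b < n + 5 ->
    nat_of_ord (nt w Q a b) = slot n Q a b.
  by move=> hQ ha hb; rewrite /nt inordK // ltnS ltnW // slot_lt.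
move=> hP hx hy hP' hx' hy' /(congr1 (@nat_of_ord _)).
by rewrite !val_nt // => E; apply: slot_inj E.
Qed.

Lemma mem_clause_rules r :
  reflect (exists c e, [/\ List.In c clauses, e \in envs w (cvars c),
                           guard w c e & r = inst w c e])
          (r \in rules G).
Proof.
apply: (iffP idP); rewrite /G /gram /=.
  elim: clauses => //= c cs IH.
  rewrite mem_cat => /orP[/mapP[e]|/IH[c' [e [hc he hg ->]]]].
    by rewrite mem_filter => /andP[hg he] ->; exists c, e; split=> //; left.
  by exists c', e; split=> //; right.
elim: clauses => [[c [e []]]//|c cs IH] [c' [e [[<-|hc] he hg E]]];
  rewrite /= mem_cat; apply/orP.
  by left; rewrite E; apply: map_f; rewrite mem_filter hg.
by right; apply: IH; exists c', e.
Qed.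

Lemma derivable_seq e b m : holds_seq derivable e b m ->
  derives_seq G (map (inst_sym w e) b) (nseq m tt).
Proof.
elim: b m => [|[[P x y]|] b IH] m /=.
- by move=> ->; constructor.
- by case=> m1 [m2 [-> h1 /IH h2]]; rewrite nseqD; constructor.
- by case=> m' -> /IH h; apply: (@derives_cons _ _ _ _ _ [:: tt]); first constructor.
Qed.

Lemma derivable_clause c e m : List.In c clauses -> size e = cvars c ->
  all (fun v => v < n) e -> guard w c e ->
  (forall b, List.In b (cbody c :: crest c) -> holds_seq derivable e b m) ->
  derivable (apred (chead c)) (term_val e (aarg1 (chead c)))
    (term_val e (aarg2 (chead c))) m.
Proof.
move=> hc he hv hg hb; apply: (@derives_rule _ _ G (inst w c e)).
  by apply/mem_clause_rules; exists c, e; split=> //; rewrite mem_envs he eqxx.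
move=> a; rewrite /conjuncts /= -[_ :: _]/(map (map (inst_sym w e)) (cbody c :: crest c)).
elim: (cbody c :: crest c) hb => //= b bs IH hb; rewrite inE => /orP[/eqP ->|].
  by apply/derivable_seq/hb; left.
by apply: IH => b' hb'; apply: hb; right.
Qed.

Lemma clause_okP c : List.In c clauses -> clause_ok c.
Proof. by elim: clauses clauses_ok => //= c' cs IH /andP[hc hcs] [<-|/(IH hcs)]. Qed.

(** Induction on derivations. The range conditions are what makes [nt] injective, so that the head
    of the applied rule can be identified with the triple in question. *)
Lemma derivable_sound (D : nat -> nat -> nat -> nat -> Prop) :
  (forall c e m, List.In c clauses -> size e = cvars c ->
     all (fun v => v < n) e -> guard w c e ->
     (forall b, List.In b (cbody c :: crest c) -> holds_seq D e b m) ->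
     D (apred (chead c)) (term_val e (aarg1 (chead c)))
       (term_val e (aarg2 (chead c))) m) ->
  forall P x y m, P < 8 -> x < n + 5 -> y < n + 5 -> derivable P x y m -> D P x y m.
Proof.
move=> hD.
(* A word over one letter is known by its size. For sequences of symbols the invariant ranges over
   all clause bodies and environments that instantiate to the sequence. *)
pose I (X : nterm w + unit) (u : seq unit) := match X with
  | inl i => forall P x y, P < 8 -> x < n + 5 -> y < n + 5 -> i = nt w P x y ->
             D P x y (size u)
  | inr _ => size u = 1 end.
suff H X u : derives G X u -> I X u.
  move=> P x y m hP hx hy /H h.
  by have := h P x y hP hx hy erefl; rewrite size_nseq.
move: X u; apply: (@derives_mut _ _ G (fun X u _ => I X u)
  (fun a u _ => forall e b k, size e = k -> all (fun v => v < n) e ->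
     all (sym_ok k) b -> a = map (inst_sym w e) b -> holds_seq D e b (size u))).
- by [].
- move=> _ u /mem_clause_rules[c [e [hc he hg ->]]] _ IH P x y hP hx hy.
  move: he; rewrite mem_envs => /andP[/eqP hs hv].
  have /and4P[_ hh hb hr] := clause_okP hc.
  have [Ph xh yh] := and3P hh.
  rewrite /rule_head /= /inst_atom.
  case/nt_inj; rewrite ?(term_val_lt xh hs) ?(term_val_lt yh hs) //.
  move=> <- <- <-; apply: hD => // b hbc.
  have ok : all (sym_ok (cvars c)) b.
    case: hbc => [<- //|]; elim: (crest c) hr => //= b' bs IHb /andP[h1 h2] [<-//|].
    exact: IHb.
  apply: (IH (map (inst_sym w e) b) _ e b (cvars c)) => //.
  rewrite /conjuncts /= -[_ :: _]/(map (map (inst_sym w e)) (cbody c :: crest c)).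
  elim: (_ :: _) hbc => //= b' bs IHb [->|/IHb]; rewrite inE ?eqxx // => ->.
  exact: orbT.
- by move=> e [|//] k.
- move=> X a u v _ IH1 _ IH2 e [//|s b] k he hv /= /andP[hs hb] [EX Ea].
  have {}IH2 := IH2 e b k he hv hb Ea.
  rewrite size_cat; case: s EX hs => [[P x y]|] /= EX hs.
    exists (size u), (size v); split=> //; move: IH1; rewrite EX /=.
    case/and3P: hs => hP hx hy.
    by apply; rewrite ?(term_val_lt hx he) ?(term_val_lt hy he).
  by move: IH1; rewrite EX /= => ->; exists (size v).
Qed.

End Clauses.

(** * The clauses *)

(* Predicates 0 and 1 state that position x carries that bit (y is then 0).
   P_word and P_unary: a coded word, resp. number, starts at x and ends before
   y; P_count does the same but derives c^m for the number m.  P_same: equal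
   words at x and y.  P_start: an inclusion of the TBox starts at x.  P_ent: the
   names at x and y are related by ○^m.  Only P_count and P_ent derive nonempty
   words. *)
Notation P_word := 2 (only parsing).
Notation P_unary := 3 (only parsing).
Notation P_count := 4 (only parsing).
Notation P_same := 5 (only parsing).
Notation P_start := 6 (only parsing).
Notation P_ent := 7 (only parsing).

Definition var (i : nat) : term := Rel i 0.
Definition sym (P : nat) (x y : term) : option atom := Some (Atom P x y).
Definition bit (b : bool) (x : term) : option atom := sym b x (At 0).
Definition word := sym P_word.
Definition una := sym P_unary.
Definition cnt := sym P_count.
Definition same := sym P_same.
Definition begins (x : term) : option atom := sym P_start x (At 0).
Definition ent := sym P_ent.

(* An inclusion with tag b1 b2 starts at variable i. *)
Definition opening (i : nat) (b1 b2 : bool) : seq (option atom) :=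
  [:: begins (var i); bit true (var i); bit b1 (Rel i 1); bit b2 (Rel i 2)].

Definition bit_clause (b : bool) : clause :=
  Clause 1 (Some b) (Atom b (var 0) (At 0)) [::] [::].
Definition plain k P x y body rest : clause :=
  Clause k None (Atom P x y) body rest.

(* The last two clauses are the existential rule, for rigid and for local
   roles. *)
Definition clauses : seq clause := [::
  bit_clause false;
  bit_clause true;
  plain 1 P_word (var 0) (Rel 0 1) [:: bit false (var 0)] [::];
  plain 2 P_word (var 0) (var 1) [:: bit true (var 0); word (Rel 0 2) (var 1)] [::];
  plain 1 P_unary (var 0) (Rel 0 1) [:: bit false (var 0)] [::];
  plain 2 P_unary (var 0) (var 1) [:: bit true (var 0); una (Rel 0 1) (var 1)] [::];
  plain 1 P_count (var 0) (Rel 0 1) [:: bit false (var 0)] [::];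
  plain 2 P_count (var 0) (var 1) [:: bit true (var 0); None; cnt (Rel 0 1) (var 1)] [::];
  plain 2 P_same (var 0) (var 1) [:: bit false (var 0); bit false (var 1)] [::];
  plain 2 P_same (var 0) (var 1) [:: bit true (var 0); bit true (var 1);
    bit false (Rel 0 1); bit false (Rel 1 1); same (Rel 0 2) (Rel 1 2)] [::];
  plain 2 P_same (var 0) (var 1) [:: bit true (var 0); bit true (var 1);
    bit true (Rel 0 1); bit true (Rel 1 1); same (Rel 0 2) (Rel 1 2)] [::];
  plain 0 P_start (At 0) (At 0) [::] [::];
  plain 4 P_start (var 3) (At 0) (opening 0 false false ++
    [:: word (Rel 0 3) (var 1); una (Rel 1 1) (var 2); word (var 2) (var 3)]) [::];
  plain 4 P_start (var 3) (At 0) (opening 0 false true ++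
    [:: word (Rel 0 3) (var 1); word (var 1) (var 2); word (var 2) (var 3)]) [::];
  plain 4 P_start (var 3) (At 0) (opening 0 true false ++
    [:: word (Rel 0 4) (var 1); word (var 1) (var 2); word (var 2) (var 3)]) [::];
  plain 4 P_start (var 3) (At 0) (opening 0 true true ++
    [:: word (Rel 0 3) (var 1); word (Rel 1 1) (var 2); word (var 2) (var 3)]) [::];
  plain 2 P_ent (var 0) (var 1) [:: same (var 0) (var 1)] [::];
  plain 3 P_ent (var 0) (var 2) [:: ent (var 0) (var 1); ent (var 1) (var 2)] [::];
  plain 3 P_ent (Rel 0 3) (var 2) (opening 0 false false ++
    [:: word (Rel 0 3) (var 1); cnt (Rel 1 1) (var 2)]) [::];
  plain 4 P_ent (var 3) (var 2) (opening 0 false true ++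
    [:: word (Rel 0 3) (var 1); word (var 1) (var 2); ent (var 3) (Rel 0 3)])
    [:: [:: ent (var 3) (var 1)]];
  plain 6 P_ent (Rel 0 3) (var 5) (opening 0 true true ++
    [:: word (Rel 0 3) (var 1); word (Rel 1 1) (var 2)] ++ opening 3 true false ++
    [:: word (Rel 3 4) (var 4); word (var 4) (var 5); same (Rel 1 1) (Rel 3 4);
        bit true (var 1); ent (var 2) (var 4)]) [::];
  plain 6 P_ent (Rel 0 3) (var 5) (opening 0 true true ++
    [:: word (Rel 0 3) (var 1); word (Rel 1 1) (var 2)] ++ opening 3 true false ++
    [:: word (Rel 3 4) (var 4); word (var 4) (var 5); same (Rel 1 1) (Rel 3 4);
        ent (var 2) (var 4)]) [:: [::]]
].

Lemma clauses_ok : all clause_ok clauses.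
Proof. by []. Qed.

(** Prefix-freeness: at most one word can be read at a given position. *)
Lemma code_word_cat_inj s s' u u' :
  code_word s ++ u = code_word s' ++ u' -> s = s' /\ u = u'.
Proof.
elim: s s' => [|b s IH] [|b' s'] //=; first by case.
by case=> -> /IH[-> ->].
Qed.

Lemma code_unary_cat_inj m m' u u' :
  code_unary m ++ u = code_unary m' ++ u' -> m = m' /\ u = u'.
Proof.
elim: m m' => [|m IH] [|m'] //=; first by case.
by case=> /IH[-> ->].
Qed.

Lemma code_list_cons (X : Type) (f : X -> seq bool) x s :
  code_list f (x :: s) = true :: f x ++ code_list f s.
Proof. by rewrite /code_list /= -catA. Qed.

(** * Reading the input: what the grammar derives about an encoded TBox *)

Section Words.
Variable w : seq bool.
Let n := size w.

Definition occ (x : nat) (s : seq bool) : Prop := exists u, drop x w = s ++ u.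

Lemma drop_lt x : drop x w <> [::] -> x < n.
Proof. by rewrite ltnNge => h; apply/negP=> le; apply: h; rewrite drop_oversize. Qed.

Lemma drop_add x s u : drop x w = s ++ u -> drop (x + size s) w = u.
Proof. by move=> E; rewrite addnC -drop_drop E drop_size_cat. Qed.

Lemma drop_consE x b u : drop x w = b :: u ->
  [/\ x < n, nth false w x = b & drop x.+1 w = u].
Proof.
move=> E; have lt : x < n by apply: drop_lt; rewrite E.
by move: E; rewrite (drop_nth false lt) => -[-> ->].
Qed.

Lemma drop_nthE x b : x < n -> nth false w x = b -> drop x w = b :: drop x.+1 w.
Proof. by move=> lt <-; rewrite (drop_nth false lt). Qed.

Lemma occ_word_inj x s s' : occ x (code_word s) -> occ x (code_word s') -> s = s'.
Proof. by move=> [u E] [u']; rewrite E => /code_word_cat_inj[]. Qed.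

Lemma occ_lt x s : s <> [::] -> occ x s -> x < n.
Proof. by move=> hs [u E]; apply: drop_lt; rewrite E; case: s hs {E}. Qed.

Lemma code_word_neq0 s : code_word s <> [::].
Proof. by case: s. Qed.

Definition is_bit (b : bool) (x : nat) : Prop := x < n /\ nth false w x = b.
Definition is_word (x y : nat) : Prop :=
  exists2 s, occ x (code_word s) & y = x + size (code_word s).
Definition is_unary (x y m : nat) : Prop :=
  occ x (code_unary m) /\ y = x + size (code_unary m).
Definition is_same (x y : nat) : Prop :=
  exists2 s, occ x (code_word s) & occ y (code_word s).

Lemma occ_cons b x s : is_bit b x -> occ x.+1 s -> occ x (b :: s).
Proof. by move=> [lt hb] [u E]; exists u; rewrite (drop_nthE lt hb) E. Qed.

Lemma is_wordE x y s u : drop x w = code_word s ++ u -> is_word x y ->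
  drop y w = u.
Proof.
move=> E [s' [u' E'] ->]; move: E'; rewrite E => /code_word_cat_inj[<- _].
exact: drop_add E.
Qed.

Lemma is_unaryE x y m m' u : drop x w = code_unary m ++ u -> is_unary x y m' ->
  m' = m /\ drop y w = u.
Proof.
move=> E [[u' E'] ->]; move: E'; rewrite E => /code_unary_cat_inj[<- _].
by split=> //; apply: drop_add E.
Qed.

Lemma is_word_cons x y : is_bit true x -> is_word x.+2 y -> is_word x y.
Proof.
move=> hx [s hs ->]; have lt := occ_lt (@code_word_neq0 s) hs.
exists (nth false w x.+1 :: s); last by rewrite /= !addSnnS.
by apply: occ_cons => //; apply: occ_cons => //; split=> //; apply: ltnW.
Qed.

Lemma is_same_cons b x y : is_bit true x -> is_bit true y ->
  is_bit b x.+1 -> is_bit b y.+1 -> is_same x.+2 y.+2 -> is_same x y.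
Proof.
move=> hx hy hx' hy' [s h1 h2].
by exists (b :: s); apply: occ_cons => //; apply: occ_cons.
Qed.

Notation dv := (derivable clauses w).
Notation hs := (holds_seq dv).

Lemma hs_eps P x y e b m : dv P (term_val e x) (term_val e y) 0 -> hs e b m ->
  hs e (Some (Atom P x y) :: b) m.
Proof. by exists 0, m. Qed.

Lemma hs_cons P x y e b m m' : dv P (term_val e x) (term_val e y) m ->
  hs e b m' -> hs e (Some (Atom P x y) :: b) (m + m').
Proof. by exists m, m'. Qed.

Lemma hs_last P x y e m : dv P (term_val e x) (term_val e y) m ->
  hs e [:: Some (Atom P x y)] m.
Proof. by rewrite -{2}[m]addn0; exists m, 0. Qed.

Lemma clause_nth k e m : let c := nth (bit_clause false) clauses k in
  k < size clauses -> size e = cvars c ->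
  all (fun v => v < n) e -> guard w c e -> hs e (cbody c) m ->
  (forall b, List.In b (crest c) -> hs e b m) ->
  dv (apred (chead c)) (term_val e (aarg1 (chead c)))
    (term_val e (aarg2 (chead c))) m.
Proof.
move=> c hk he hv hg hb hr; apply: derivable_clause => // [|b [<-|/hr]//].
rewrite /c; elim: clauses k hk {c he hv hg hb hr} => //= c cs IH [|k] hk; first by left.
by right; apply: IH.
Qed.

Ltac use_clause k e :=
  apply: (@clause_nth k e);
  [by [] | by [] | by do ?[apply/andP; split] | try by [] |
   cbv [nth clauses cbody plain bit_clause]; try by [] |
   cbv [nth clauses crest plain bit_clause]; try by []].

Lemma dv_bit b x : is_bit b x -> dv b x 0 0.
Proof.
case: b => -[lt hb].
- by use_clause 1 [:: x]; rewrite /guard /= hb.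
- by use_clause 0 [:: x]; rewrite /guard /= hb.
Qed.

(** Clause variables range over positions below [n], so the end [y] of the word must be a position
    itself. This is what [u <> [::]] ensures; inside the code of a TBox at least the final end mark
    follows. *)
Lemma dv_word x s u : drop x w = code_word s ++ u -> u <> [::] ->
  exists2 y, y < n & dv P_word x y 0 /\ drop y w = u.
Proof.
elim: s x => [|b s IH] x /= E hu.
  have [lt hb E'] := drop_consE E; have lt' : x.+1 < n by apply: drop_lt; rewrite E'.
  exists x.+1 => //; split=> //; use_clause 2 [:: x].
  by apply: hs_last; exact: dv_bit (conj lt hb).
have [lt hb /drop_consE[_ _ E']] := drop_consE E.
have [y ly [hy Ey]] := IH _ E' hu; exists y => //; split=> //.
use_clause 3 [:: x; y].
by apply: hs_eps; [exact: dv_bit | exact: hs_last].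
Qed.

Lemma dv_unary x m u : drop x w = code_unary m ++ u -> u <> [::] ->
  exists2 y, y < n & [/\ dv P_unary x y 0, dv P_count x y m & drop y w = u].
Proof.
elim: m x => [|m IH] x /= E hu.
  have [lt hb E'] := drop_consE E; have lt' : x.+1 < n by apply: drop_lt; rewrite E'.
  exists x.+1 => //; split=> //.
    use_clause 4 [:: x].
    by apply: hs_last; exact: dv_bit (conj lt hb).
  use_clause 6 [:: x].
  by apply: hs_last; exact: dv_bit (conj lt hb).
have [lt hb E'] := drop_consE E.
have [y ly [hy hy' Ey]] := IH _ E' hu; exists y => //; split=> //.
  use_clause 5 [:: x; y].
  by apply: hs_eps; [exact: dv_bit | exact: hs_last].
use_clause 7 [:: x; y].
by apply: hs_eps; [exact: dv_bit | exists m => //; exact: hs_last].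
Qed.

Lemma dv_same s x y : occ x (code_word s) -> occ y (code_word s) -> dv P_same x y 0.
Proof.
elim: s x y => [|b s IH] x y [u /= Ex] [u' /= Ey].
  have [lx hx _] := drop_consE Ex; have [ly hy _] := drop_consE Ey.
  use_clause 8 [:: x; y].
  by apply: hs_eps; [exact: dv_bit | apply: hs_last; exact: dv_bit].
have [lx hx Ex'] := drop_consE Ex; have [ly hy Ey'] := drop_consE Ey.
have [lx' hx' Ex''] := drop_consE Ex'; have [ly' hy' Ey''] := drop_consE Ey'.
have h : dv P_same x.+2 y.+2 0 by apply: IH; [exists u | exists u'].
have hx0 := dv_bit (conj lx hx); have hy0 := dv_bit (conj ly hy).
have hx1 := dv_bit (conj lx' hx'); have hy1 := dv_bit (conj ly' hy').
case: b {Ex Ey Ex' Ey'} hx' hy' hx1 hy1 => hx' hy' hx1 hy1.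
- use_clause 10 [:: x; y].
  by do 4![apply: hs_eps => //]; apply: hs_last.
- use_clause 9 [:: x; y].
  by do 4![apply: hs_eps => //]; apply: hs_last.
Qed.

Lemma dv_ent_same s x y : occ x (code_word s) -> occ y (code_word s) -> dv P_ent x y 0.
Proof.
move=> hx hy; have lx := occ_lt (@code_word_neq0 s) hx.
have ly := occ_lt (@code_word_neq0 s) hy.
use_clause 16 [:: x; y].
by apply: hs_last; exact: dv_same hx hy.
Qed.

Lemma dv_ent_trans x y z m m' : x < n -> y < n -> z < n ->
  dv P_ent x y m -> dv P_ent y z m' -> dv P_ent x z (m + m').
Proof.
move=> lx ly lz h h'.
use_clause 17 [:: x; y; z].
by apply: hs_cons => //; apply: hs_last.
Qed.

Definition opened (p : nat) (b1 b2 : bool) : Prop :=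
  [/\ dv P_start p 0 0, is_bit true p, is_bit b1 p.+1 & is_bit b2 p.+2].

Lemma hs_opening e i b1 b2 b m : opened (nth 0 e i) b1 b2 -> hs e b m ->
  hs e (opening i b1 b2 ++ b) m.
Proof.
move=> [h0 h1 h2 h3] h; do 3![apply: hs_eps; first by [|exact: dv_bit]].
by apply: hs_eps; first exact: dv_bit.
Qed.

Variable V : vocabulary.
Implicit Types (A B : cname V) (r : rname V) (T : tbox V).

Definition ctor_bits (a : inclusion V) : bool * bool :=
  match a with
  | SubNext _ _ _ => (false, false)
  | MeetSub _ _ _ => (false, true)
  | ExSub _ _ _ => (true, false)
  | SubEx _ _ _ => (true, true)
  end.

Definition fields (a : inclusion V) : seq bool :=
  match a with
  | SubNext A k B => code_cname A ++ (k < 0)%R :: code_unary `|k| ++ code_cname B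
  | MeetSub A A' B => code_cname A ++ code_cname A' ++ code_cname B
  | ExSub r A B =>
      rigid r :: code_word (rname_word r) ++ code_cname A ++ code_cname B
  | SubEx A r B =>
      code_cname A ++ rigid r :: code_word (rname_word r) ++ code_cname B
  end.

Lemma code_inclusionE a : code_inclusion a = (ctor_bits a).1 :: (ctor_bits a).2 :: fields a.
Proof. by case: a. Qed.

Lemma code_tbox_cons a T :
  code_tbox (a :: T) = true :: (ctor_bits a).1 :: (ctor_bits a).2 :: fields a ++ code_tbox T.
Proof. by rewrite /code_tbox code_list_cons code_inclusionE. Qed.

Lemma code_tbox_neq0 T : code_tbox T <> [::].
Proof. by case: T => [|a T] //; rewrite code_tbox_cons. Qed.

Lemma cat_neq0 (s u : seq bool) : u <> [::] -> s ++ u <> [::].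
Proof. by case: s. Qed.

Lemma cons_neq0 b (u : seq bool) : b :: u <> [::].
Proof. by []. Qed.

Definition at_inclusion (p : nat) (a : inclusion V) (T : tbox V) : Prop :=
  opened p (ctor_bits a).1 (ctor_bits a).2 /\ drop p.+3 w = fields a ++ code_tbox T.

Lemma at_inclusionI p a T : dv P_start p 0 0 -> drop p w = code_tbox (a :: T) ->
  at_inclusion p a T.
Proof.
rewrite code_tbox_cons => hp /drop_consE[l0 b0 /drop_consE[l1 b1 /drop_consE[l2 b2]]].
by move=> E; split.
Qed.

Lemma occI x s u : drop x w = s ++ u -> occ x s.
Proof. by exists u. Qed.

Lemma opened_lt p b1 b2 : opened p b1 b2 -> p < n.
Proof. by case=> _ []. Qed.

Lemma site_next p A k B T : at_inclusion p (SubNext A k B) T ->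
  exists b e, [/\ occ p.+3 (code_cname A), occ b (code_cname B),
    dv P_ent p.+3 b `|k|, drop e w = code_tbox T & dv P_start e 0 0].
Proof.
move=> [ho]; rewrite /= -catA /= -catA => E; have lp := opened_lt ho.
have [i li [hi Ei]] := dv_word E (@cons_neq0 _ _).
(* The sign bit is stepped over, so the derived delay is the absolute value of the shift. *)
have [_ _ Ei'] := drop_consE Ei.
have [b lb [hb hb' Eb]] := dv_unary Ei' (cat_neq0 (@code_tbox_neq0 T)).
have [e le [he Ee]] := dv_word Eb (@code_tbox_neq0 T).
exists b, e; split=> //; [exact: occI E | exact: occI Eb | |].
- use_clause 18 [:: p; i; b]; apply: hs_opening => //.
  by apply: hs_eps => //; apply: hs_last.
- use_clause 12 [:: p; i; b; e]; apply: hs_opening => //.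
  by apply: hs_eps => //; apply: hs_eps => //; apply: hs_last.
Qed.

Lemma site_meet p A A' B T : at_inclusion p (MeetSub A A' B) T ->
  exists a b e, [/\ occ p.+3 (code_cname A), occ a (code_cname A'),
    occ b (code_cname B), drop e w = code_tbox T & dv P_start e 0 0] /\
    forall x m, x < n -> dv P_ent x p.+3 m -> dv P_ent x a m -> dv P_ent x b m.
Proof.
move=> [ho]; rewrite /= -(catA (code_cname A)) -(catA (code_cname A')) => E; have lp := opened_lt ho.
have [a la [ha Ea]] := dv_word E (cat_neq0 (cat_neq0 (@code_tbox_neq0 T))).
have [b lb [hb Eb]] := dv_word Ea (cat_neq0 (@code_tbox_neq0 T)).
have [e le [he Ee]] := dv_word Eb (@code_tbox_neq0 T).
exists a, b, e; split.
  split=> //; [exact: occI E | exact: occI Ea | exact: occI Eb |].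
  use_clause 13 [:: p; a; b; e]; apply: hs_opening => //.
  by apply: hs_eps => //; apply: hs_eps => //; apply: hs_last.
move=> x m lx h h'; use_clause 19 [:: p; a; b; x].
  apply: hs_opening => //.
  by apply: hs_eps => //; apply: hs_eps => //; apply: hs_last.
by move=> c [<-|//]; apply: hs_last.
Qed.

Lemma site_ex p r A B T : at_inclusion p (ExSub r A B) T ->
  exists a b e, [/\ occ p.+4 (code_word (rname_word r)), occ a (code_cname A),
    occ b (code_cname B), drop e w = code_tbox T & dv P_start e 0 0] /\
    (dv P_word p.+4 a 0 /\ dv P_word a b 0).
Proof.
move=> [ho]; rewrite /= -(catA (code_word _)) -(catA (code_cname A)).
move=> /drop_consE[_ _ E]; have lp := opened_lt ho.
have [a la [ha Ea]] := dv_word E (cat_neq0 (cat_neq0 (@code_tbox_neq0 T))).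
have [b lb [hb Eb]] := dv_word Ea (cat_neq0 (@code_tbox_neq0 T)).
have [e le [he Ee]] := dv_word Eb (@code_tbox_neq0 T).
exists a, b, e; split=> //.
split=> //; [exact: occI E | exact: occI Ea | exact: occI Eb |].
use_clause 14 [:: p; a; b; e]; apply: hs_opening => //.
by apply: hs_eps => //; apply: hs_eps => //; apply: hs_last.
Qed.

Lemma site_subex p A r B T : at_inclusion p (SubEx A r B) T ->
  exists c b e, [/\ occ p.+3 (code_cname A), occ c.+1 (code_word (rname_word r)),
    occ b (code_cname B), drop e w = code_tbox T & dv P_start e 0 0] /\
    [/\ dv P_word p.+3 c 0, is_bit (rigid r) c & dv P_word c.+1 b 0].
Proof.
move=> [ho]; rewrite /= -catA /= -catA => E; have lp := opened_lt ho.
have [c lc [hc Ec]] := dv_word E (@cons_neq0 _ _).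
have [_ bc Ec'] := drop_consE Ec.
have [b lb [hb Eb]] := dv_word Ec' (cat_neq0 (@code_tbox_neq0 T)).
have [e le [he Ee]] := dv_word Eb (@code_tbox_neq0 T).
exists c, b, e; split=> //.
split=> //; [exact: occI E | exact: occI Ec' | exact: occI Eb |].
use_clause 15 [:: p; c; b; e]; apply: hs_opening => //.
by apply: hs_eps => //; apply: hs_eps => //; apply: hs_last.
Qed.

(** The rule refers to the occurrences of [B] and [A'] inside the two inclusions. These are found
    only in the proof, hence the last hypothesis covers all occurrences. *)
Lemma dv_exists p q A r B A' B' T T' m :
  at_inclusion p (SubEx A r B) T -> at_inclusion q (ExSub r A' B') T' ->
  (~~ rigid r -> m = 0) ->
  (forall b a, occ b (code_cname B) -> occ a (code_cname A') -> dv P_ent b a m) ->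
  exists2 b', occ b' (code_cname B') & dv P_ent p.+3 b' m.
Proof.
move=> hp hq hr hm; have [hop _] := hp; have [hoq _] := hq.
have lp := opened_lt hop; have lq := opened_lt hoq.
have [c [b [_ [[_ oc ob _ _] [dc bc db]]]]] := site_subex hp.
have [a [b' [_ [[oq oa ob' _ _] [da db']]]]] := site_ex hq.
have lb := occ_lt (@code_word_neq0 _) ob; have la := occ_lt (@code_word_neq0 _) oa.
have lb' := occ_lt (@code_word_neq0 _) ob'; have [lc _] := bc.
exists b' => //.
have hs5 := dv_same oc oq; have h := hm b a ob oa.
case Er: (rigid r) bc hr => bc hr.
- use_clause 20 [:: p; c; b; q; a; b']; apply: hs_opening => //.
  apply: hs_eps => //; apply: hs_eps => //; apply: hs_opening => //.
  do 3![apply: hs_eps => //]; apply: hs_eps; first exact: dv_bit bc.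
  exact: hs_last.
- use_clause 21 [:: p; c; b; q; a; b'].
    apply: hs_opening => //.
    apply: hs_eps => //; apply: hs_eps => //; apply: hs_opening => //.
    by do 3![apply: hs_eps => //]; apply: hs_last.
  (* The additional empty conjunct asks for [m = 0]. *)
  by move=> x [<-|//]; rewrite hr.
Qed.

Lemma next_start p a T : at_inclusion p a T ->
  exists2 e, drop e w = code_tbox T & dv P_start e 0 0.
Proof.
case: a => [A k B|A A' B|r A B|A r B] h.
- by have [b [e []]] := site_next h; exists e.
- by have [a [b [e [[]]]]] := site_meet h; exists e.
- by have [a [b [e [[]]]]] := site_ex h; exists e.
- by have [a [b [e [[]]]]] := site_subex h; exists e.
Qed.

Lemma dv_start : dv P_start 0 0 0.
Proof. by use_clause 11 (@nil nat). Qed.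

(** Parsing proceeds along the list: the end of one inclusion is derived to be the start of the
    next. *)
Lemma at_inclusion_all p T : dv P_start p 0 0 -> drop p w = code_tbox T ->
  forall a, List.In a T -> exists q T', at_inclusion q a T'.
Proof.
elim: T p => //= a T IH p hp E a' ha.
have h := at_inclusionI hp E.
case: ha => [<-|ha]; first by exists p, T.
by have [e Ee he] := next_start h; apply: (IH e).
Qed.

End Words.

(** * Soundness *)

Section Semantics.
Variable V : vocabulary.
Variable T : tbox V.
Implicit Types (A B : cname V) (r : rname V).
Let w := code_tbox T.
Let n := size w.

Lemma entails_next A m B : entails T (Name A) (Next (Posz m) B) <->
  forall I : interpretation V, model I T ->
    forall i d, @cext _ I i A d -> @cext _ I (i + Posz m)%R B d.
Proof.
split=> h I hI i d; have := h I hI i d; rewrite /= GRing.addr0 //.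
Qed.

Lemma occ_cname_inj x A B : occ w x (code_cname A) -> occ w x (code_cname B) ->
  A = B.
Proof. by move=> h h'; apply/cname_word_inj/(occ_word_inj h h'). Qed.

Lemma size_code_unary m : size (code_unary m) = m.+1.
Proof. by rewrite /code_unary size_cat size_nseq addn1. Qed.

Definition starts (x : nat) : Prop :=
  exists2 T', drop x w = code_tbox T' & forall a, List.In a T' -> List.In a T.

(** The reflexive clause relates any two equal words, also where a role name is written or in the
    middle of another field. The conditional form keeps such instances sound: without a concept name
    at [x] nothing is claimed. *)
Definition entails_at (x y m : nat) : Prop :=
  forall A, occ w x (code_cname A) -> exists2 B, occ w y (code_cname B) &
    entails T (Name A) (Next (Posz m) B).

Definition meaning (P x y m : nat) : Prop :=
  match P with
  | 0 => m = 0 /\ is_bit w false x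
  | 1 => m = 0 /\ is_bit w true x
  | 2 => m = 0 /\ is_word w x y
  | 3 => m = 0 /\ exists k, is_unary w x y k
  | 4 => is_unary w x y m
  | 5 => m = 0 /\ is_same w x y
  | 6 => m = 0 /\ starts x
  | _ => entails_at x y m
  end.

(** Only counting and entailment allow nonempty words; any other leading symbol is a pure side
    condition and leaves the length to the rest of the body. *)
Lemma meaning_cons P x y e b m : P \notin [:: 4; 7] -> P < 8 ->
  holds_seq meaning e (Some (Atom P x y) :: b) m ->
  meaning P (term_val e x) (term_val e y) 0 /\ holds_seq meaning e b m.
Proof.
move=> hP hP' [m1 [m2 [-> h]]].
suff E : m1 = 0 by rewrite E in h *.
by move: P hP hP' h => [|[|[|[|[|[|[|[|P]]]]]]]] //= _ _ [].
Qed.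

Lemma meaning_opening e i b1 b2 b m :
  holds_seq meaning e (opening i b1 b2 ++ b) m ->
  (exists a T', [/\ (ctor_bits a = (b1, b2)), List.In a T,
     forall a', List.In a' T' -> List.In a' T &
     drop (nth 0 e i).+3 w = fields a ++ code_tbox T']) /\
  holds_seq meaning e b m.
Proof.
case/meaning_cons=> // -[_ [T' E hT']].
case/meaning_cons=> // -[_ [l0 h0]].
case/meaning_cons=> [||h1]; [by case: (b1) | by case: (b1) |].
case/meaning_cons=> [||h2 hb]; [by case: (b2) | by case: (b2) |].
split=> //; have {}h1 : is_bit w b1 (nth 0 e i).+1 by case: (b1) h1 => -[].
have {}h2 : is_bit w b2 (nth 0 e i).+2 by case: (b2) h2 => -[].
(* The bit 1 at this position excludes the empty TBox, whose code starts with 0. *)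
case: T' E hT' => [|a T'] E hT'; first by case/drop_consE: E h0 => _ ->.
move: E; rewrite code_tbox_cons.
case/drop_consE=> _ _ /drop_consE[_ e1 /drop_consE[_ e2 E]].
exists a, T'; split=> //; [|by apply: hT'; left|by move=> a' h; apply: hT'; right].
by rewrite -(proj2 h1) -(proj2 h2) e1 e2; case: (ctor_bits a).
Qed.

Lemma entails_exists p c b q a b' A r B (T1 : tbox V) A' r' B' (T2 : tbox V) m :
  List.In (SubEx A r B) T -> List.In (ExSub r' A' B') T ->
  drop p.+3 w = fields (SubEx A r B) ++ code_tbox T1 ->
  drop q.+3 w = fields (ExSub r' A' B') ++ code_tbox T2 ->
  is_word w p.+3 c -> is_word w c.+1 b -> is_word w q.+4 a -> is_word w a b' ->
  is_same w c.+1 q.+4 -> entails_at b a m ->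
  (is_bit w true c \/ m = 0) -> entails_at p.+3 b' m.
Proof.
move=> hT hT'; rewrite /= -catA /= -catA => E.
rewrite -(catA (code_word _)) -(catA (code_cname A')) => /drop_consE[_ _ E'].
move=> hc hb1 ha hb2 [s hs1 hs2] hba hr.
have [_ er Ec] := drop_consE (is_wordE E hc); have Eb := is_wordE Ec hb1.
have Ea := is_wordE E' ha; have Eb' := is_wordE Ea hb2.
have {E'}Er : r' = r.
  apply: rname_word_inj.
  by rewrite (occ_word_inj (occI E') hs2) (occ_word_inj (occI Ec) hs1).
subst r' => A0 /(occ_cname_inj (occI E)) <-; exists B'; first exact: occI Eb'.
have [A1 /(occ_cname_inj (occI Ea)) <- hBA'] := hba B (occI Eb).
apply/entails_next=> I hI i d hd.
have := hI _ hT i d; rewrite /= GRing.addr0 => /(_ hd) [e1 [he1 hr1]].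
have := hI _ hT' (i + Posz m)%R d; rewrite /= GRing.addr0; apply.
exists e1; split; first by move/entails_next: hBA'; apply.
(* The edge is given at time [i] and needed at [i + m]: either rigidity carries it over or [m] is
   0. *)
case: hr => [[_ h]|->]; last by rewrite GRing.addr0.
have rig : rigid r by rewrite -er.
exact: (proj1 (@rext_rigid _ I r rig i (i + Posz m)%R d e1)).
Qed.

Hypothesis T_future : future T.

Lemma meaning_closed c e m : List.In c clauses -> size e = cvars c ->
  all (fun v => v < n) e -> guard w c e ->
  (forall b, List.In b (cbody c :: crest c) -> holds_seq meaning e b m) ->
  meaning (apred (chead c)) (term_val e (aarg1 (chead c)))
    (term_val e (aarg2 (chead c))) m.
Proof.
move=> hc he hv hg hb; have := hb _ (or_introl erefl).
case: hc he hv hg hb => [<-|]; first case: e => [|x []] // _ /andP[lx _] /eqP hg _ /= ->.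
  by split.
case=> [<-|]; first case: e => [|x []] // _ /andP[lx _] /eqP hg _ /= ->.
  by split.
case=> [<-|]; first case: e => [|x []] // _ _ _ _.
  case/meaning_cons=> // -[_ hx] /= ->; split=> //; exists [::].
    by apply: occ_cons => //; exists (drop x.+1 w).
  by rewrite addn1.
case=> [<-|]; first case: e => [|x [|y []]] // _ _ _ _.
  case/meaning_cons=> // -[_ hx] /meaning_cons[] // [_ hy] /= ->.
  by split=> //; apply: is_word_cons.
case=> [<-|]; first case: e => [|x []] // _ _ _ _.
  case/meaning_cons=> // -[_ hx] /= ->; split=> //; exists 0; split; last by rewrite addn1.
  by apply: occ_cons => //; exists (drop x.+1 w).
case=> [<-|]; first case: e => [|x [|y []]] // _ _ _ _.
  case/meaning_cons=> // -[_ hx] /meaning_cons[] // [_ [k [h E]]] /= ->.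
  split=> //; exists k.+1; split; first exact: occ_cons.
  by move: E; rewrite !size_code_unary /=; lia.
case=> [<-|]; first case: e => [|x []] // _ _ _ _.
  case/meaning_cons=> // -[_ hx] /= ->; split=> //; last by rewrite addn1.
  by apply: occ_cons => //; exists (drop x.+1 w).
case=> [<-|]; first case: e => [|x [|y []]] // _ _ _ _.
  case/meaning_cons=> // -[_ hx] [k ->] [m1 [m2 [-> [h E] /= ->]]]; rewrite addn0.
  split; first exact: occ_cons.
  by move: E; rewrite !size_code_unary /=; lia.
case=> [<-|]; first case: e => [|x [|y []]] // _ _ _ _.
  case/meaning_cons=> // -[_ hx] /meaning_cons[] // [_ hy] /= ->.
  split=> //; exists [::]; apply: occ_cons => //;
    [by exists (drop x.+1 w) | by exists (drop y.+1 w)].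
do 2![case=> [<-|]; first (case: e => [|x [|y []]] // _ _ _ _;
  case/meaning_cons=> // -[_ hx] /meaning_cons[] // [_ hy] /meaning_cons[] // [_ hx']
    /meaning_cons[] // [_ hy'] /meaning_cons[] // [_ h] /= ->;
  by split=> //; apply: (is_same_cons hx hy hx' hy'))].
case=> [<-|]; first case: e => [|//] // _ _ _ _ /= ->.
  by split=> //; exists T => //; rewrite drop0.
case=> [<-|]; first case: e => [|p [|i [|b [|e []]]]] // _ _ _ _.
  case/meaning_opening=> -[a0 [T' [Ea hT0 hT' E0]]]; case: a0 Ea hT0 E0 => // A k B _ _ E.
  case/meaning_cons=> // -[_ hi] /meaning_cons[] // [_ [l hb]] /meaning_cons[] // [_ he] /= ->.
  split=> //; exists T' => //; move: E; rewrite /= -catA /= -catA => E.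
  have [_ _ Ei] := drop_consE (is_wordE E hi).
  by have [_ Eb] := is_unaryE Ei hb; apply: is_wordE Eb he.
case=> [<-|]; first case: e => [|p [|a [|b [|e []]]]] // _ _ _ _.
  case/meaning_opening=> -[a0 [T' [Ea hT0 hT' E0]]]; case: a0 Ea hT0 E0 => // A A' B _ _ E.
  case/meaning_cons=> // -[_ ha] /meaning_cons[] // [_ hb] /meaning_cons[] // [_ he] /= ->.
  split=> //; exists T' => //; move: E.
  rewrite /= -(catA (code_cname A)) -(catA (code_cname A')) => E.
  by apply: is_wordE (is_wordE (is_wordE E ha) hb) he.
case=> [<-|]; first case: e => [|p [|a [|b [|e []]]]] // _ _ _ _.
  case/meaning_opening=> -[a0 [T' [Ea hT0 hT' E0]]]; case: a0 Ea hT0 E0 => // r A B _ _ E.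
  case/meaning_cons=> // -[_ ha] /meaning_cons[] // [_ hb] /meaning_cons[] // [_ he] /= ->.
  split=> //; exists T' => //; move: E.
  rewrite /= -(catA (code_word _)) -(catA (code_cname A)) => /drop_consE[_ _ E].
  by apply: is_wordE (is_wordE (is_wordE E ha) hb) he.
case=> [<-|]; first case: e => [|p [|c' [|b [|e []]]]] // _ _ _ _.
  case/meaning_opening=> -[a0 [T' [Ea hT0 hT' E0]]]; case: a0 Ea hT0 E0 => // A r B _ _ E.
  case/meaning_cons=> // -[_ ha] /meaning_cons[] // [_ hb] /meaning_cons[] // [_ he] /= ->.
  split=> //; exists T' => //; move: E; rewrite /= -catA /= -catA => E.
  have [_ _ Ec] := drop_consE (is_wordE E ha).
  by apply: is_wordE (is_wordE Ec hb) he.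
case=> [<-|]; first case: e => [|x [|y []]] // _ _ _ _.
  case/meaning_cons=> // -[_ [s hx hy]] /= -> A hA; exists A.
    by rewrite /code_cname (occ_word_inj hA hx).
  by apply/entails_next=> I _ i d; rewrite GRing.addr0.
case=> [<-|]; first case: e => [|x [|y [|z []]]] // _ _ _ _.
  case=> m1 [m2 [-> h1 [m3 [m4 [-> h2 ->]]]]] A /h1[B hB hAB].
  have [C hC hBC] := h2 B hB; exists C => //.
  apply/entails_next=> I hI i d hd; rewrite addn0 PoszD GRing.addrA.
  by move/entails_next: hBC; apply=> //; move/entails_next: hAB; apply.
case=> [<-|]; first case: e => [|p [|i [|b []]]] // _ _ _ _.
  case/meaning_opening=> -[a0 [T' [Ea hT0 _ E0]]]; case: a0 Ea hT0 E0 => // A k B _ hT E.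
  rewrite /= -catA /= -catA in E.
  case/meaning_cons=> // -[_ hi] [m1 [m2 [-> hb ->]]].
  have [_ _ Ei] := drop_consE (is_wordE E hi).
  have [-> Eb] := is_unaryE Ei hb.
  move=> A1 /(occ_cname_inj (occI E)) <-; exists B; first exact: occI Eb.
  apply/entails_next=> I hI j d hd; have := hI _ hT j d.
  rewrite /= GRing.addr0 addn0 => /(_ hd).
  (* The counted delay is [|k|], which is the shift itself because [k] is nonnegative. *)
  by case: (k) (T_future hT).
case=> [<-|]; first case: e => [|p [|a [|b [|x []]]]] // _ _ _ hb.
  case/meaning_opening=> -[a0 [T' [Ea hT0 _ E0]]]; case: a0 Ea hT0 E0 => // A A' B _ hT E.
  rewrite /= -(catA (code_cname A)) -(catA (code_cname A')) in E.
  case/meaning_cons=> // -[_ ha] /meaning_cons[] // [_ hb'] [m1 [m2 [Em h1 Em2]]].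
  have [m3 [m4 [E' h2 E4]]] := hb _ (or_intror (or_introl erefl)).
  (* Both conjuncts derive the same word, so both names are reached with the same delay. *)
  have {h2}h2 : entails_at x a m1 by suff <- : m3 = m1 by []; lia.
  have {Em}-> : m = m1 by lia.
  have Ea := is_wordE E ha; have Eb := is_wordE Ea hb'.
  move=> C hC; exists B; first exact: occI Eb.
  have [A1 /(occ_cname_inj (occI E)) <- hA] := h1 C hC.
  have [A2 /(occ_cname_inj (occI Ea)) <- hA'] := h2 C hC.
  apply/entails_next=> I hI i d hd.
  have := hI _ hT (i + Posz m1)%R d; rewrite /= GRing.addr0; apply.
  by split; [move/entails_next: hA | move/entails_next: hA']; apply.
case=> [<-|]; first case: e => [|p [|c' [|b [|q [|a [|b' []]]]]]] // _ _ _ _.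
  case/meaning_opening=> -[a0 [T1 [Ea hT0 _ E0]]]; case: a0 Ea hT0 E0 => // A r B _ hT E.
  case/meaning_cons=> // -[_ hc] /meaning_cons[] // [_ hb1].
  case/meaning_opening=> -[a0 [T2 [Ea hT0 _ E0]]]; case: a0 Ea hT0 E0 => // r' A' B' _ hT' E'.
  case/meaning_cons=> // -[_ ha] /meaning_cons[] // [_ hb2] /meaning_cons[] // [_ hs].
  case/meaning_cons=> // -[_ hr] [m1 [m2 [-> h1 ->]]]; rewrite addn0.
  exact (entails_exists
           hT hT' E E' hc hb1 ha hb2 hs h1 (or_introl hr)).
case=> [<-|//]; case: e => [|p [|c' [|b [|q [|a [|b' []]]]]]] // _ _ _ hb.
(* The empty conjunct of the clause for local roles. *)
have -> : m = 0 := hb _ (or_intror (or_introl erefl)).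
case/meaning_opening=> -[a0 [T1 [Ea hT0 _ E0]]]; case: a0 Ea hT0 E0 => // A r B _ hT E.
case/meaning_cons=> // -[_ hc] /meaning_cons[] // [_ hb1].
case/meaning_opening=> -[a0 [T2 [Ea hT0 _ E0]]]; case: a0 Ea hT0 E0 => // r' A' B' _ hT' E'.
case/meaning_cons=> // -[_ ha] /meaning_cons[] // [_ hb2] /meaning_cons[] // [_ hs].
case=> m1 [m2 [E0 h1 _]]; have {m2 E0}m10 : m1 = 0 by lia.
subst m1.
exact (entails_exists
         hT hT' E E' hc hb1 ha hb2 hs h1 (or_intror erefl)).
Qed.

End Semantics.

(** * The canonical model *)

Section Model.
Variable V : vocabulary.
Variable T : tbox V.
Implicit Types (A B : cname V) (r : rname V).
Let w := code_tbox T.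
Let n := size w.
Notation dv := (derivable clauses w).

(* The element (x, i) is generated at time i by the concept name written at
   position x. *)
Definition canon_cext (k : int) A (d : iname V + nat * int) : Prop :=
  if d is inr (x, i) then exists y m,
    [/\ x < n, k = (i + Posz m)%R, occ w y (code_cname A) & dv P_ent x y m]
  else False.

(** The successor is created at the time [j] at which the element acquires the left-hand side [A]. A
    local edge exists at time [j] only, a rigid one at all times. *)
Definition canon_rext (k : int) r (d d' : iname V + nat * int) : Prop :=
  match d, d' with
  | inr (x, i), inr (z, j) => exists y m A B,
      [/\ x < n /\ j = (i + Posz m)%R, dv P_ent x y m,
          occ w y (code_cname A) /\ occ w z (code_cname B),
          List.In (SubEx A r B) T & ~~ rigid r -> k = j]
  | _, _ => False
  end.

Lemma canon_rext_rigid r : rigid r ->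
  forall i j d e, canon_rext i r d e <-> canon_rext j r d e.
Proof.
by move=> hr i j [x|[x k]] [z|[z l]] //=; split=> -[y [m [A [B [h1 h2 h3 h4 _]]]]];
  exists y, m, A, B; split=> //; rewrite hr.
Qed.

(** Individual names become isolated elements outside every concept, so all inclusions hold at them
    vacuously. *)
Definition canon : interpretation V :=
  @Interpretation V (iname V + nat * int)%type (inhabits (inr (0, 0%R)))
    inl (@inl_inj _ _)
    canon_cext canon_rext canon_rext_rigid.

Lemma occ_cname_lt x A : occ w x (code_cname A) -> x < n.
Proof. by apply: occ_lt; apply: code_word_neq0. Qed.

(** Moves the target to another occurrence of the same name, by composing with the zero delay
    between equal words. *)
Lemma dv_ent_occ x y z A m : x < n -> dv P_ent x y m ->
  occ w y (code_cname A) -> occ w z (code_cname A) -> dv P_ent x z m.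
Proof.
move=> lx h hy hz; rewrite -[m]addn0.
apply: (dv_ent_trans lx (occ_cname_lt hy) (occ_cname_lt hz) h).
exact: dv_ent_same hy hz.
Qed.

Lemma inclusion_at a : List.In a T -> exists p T', at_inclusion w p a T'.
Proof.
apply: (@at_inclusion_all w V 0); last by rewrite drop0.
exact: dv_start.
Qed.

Lemma cname_at A : A \in tbox_cnames T -> exists x, occ w x (code_cname A).
Proof.
move=> hA; suff [a ha hAa] : exists2 a, List.In a T & A \in inclusion_cnames a.
  have [p [T' h]] := inclusion_at ha.
  case: a hAa {ha} h => [B k C|B B' C|r B C|B r C]; rewrite !inE => + h.
  - have [b [e [h1 h2 _ _ _]]] := site_next h.
    by case/orP=> /eqP ->; [exists p.+3 | exists b].
  - have [a [b [e [[h1 h2 h3 _ _] _]]]] := site_meet h.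
    by case/or3P=> /eqP ->; [exists p.+3 | exists a | exists b].
  - have [a [b [e [[_ h1 h2 _ _] _]]]] := site_ex h.
    by case/orP=> /eqP ->; [exists a | exists b].
  - have [c [b [e [[h1 _ h2 _ _] _]]]] := site_subex h.
    by case/orP=> /eqP ->; [exists p.+3 | exists b].
elim: (T) hA => //= a T' IH; rewrite /tbox_cnames /= mem_cat.
case/orP=> [ha|/IH[a' h1 h2]]; first by exists a => //; left.
by exists a' => //; right.
Qed.

Hypothesis T_future : future T.

Lemma canon_model : model canon T.
Proof.
move=> a ha; have [p [T' h]] := inclusion_at ha.
case: a ha h => [A k B|A A' B|r A B|A r B] ha h i [d|[x j]] //=.
- rewrite GRing.addr0 => -[y [m [lx -> hy hm]]].
  have [b [e [h1 h2 h3 _ _]]] := site_next h.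
  exists b, (m + `|k|); split=> //.
    by rewrite PoszD GRing.addrA gez0_abs // (T_future ha).
  apply: (dv_ent_trans lx (occ_cname_lt h1) (occ_cname_lt h2)) h3.
  exact: dv_ent_occ hm hy h1.
- by case.
- case=> -[y [m [lx -> hy hm]]] [y' [m' [_ E hy' hm']]].
  have {E}E : m' = m by move/GRing.addrI: E => -[].
  have [a [b [e [[h1 h2 h3 _ _] hab]]]] := site_meet h.
  rewrite GRing.addr0; exists b, m; split=> //; apply: hab => //.
    exact: dv_ent_occ hm hy h1.
  by rewrite -E; apply: dv_ent_occ hm' hy' h2.
- by move=> [[z|[z l]] []].
- case=> [[z|[z l]]] [] //= [y [m [lz -> hy hm]]].
  case=> [y' [m' [A1 [B1 [[lx ->] hm' [hy' hz] hin hr]]]]].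
  have [q [T2 hq]] := inclusion_at hin.
  (* A local edge is present only at the creation time of the successor, which therefore has had no
     time to acquire [A] with a positive delay. *)
  have hmz : ~~ rigid r -> m = 0 by move=> /hr; lia.
  have [b' hb' hd] : exists2 b', occ w b' (code_cname B) & dv P_ent q.+3 b' m.
    apply: (dv_exists hq h hmz) => b a hb haa.
    rewrite -[m]add0n; have lb := occ_cname_lt hb.
    apply: (dv_ent_trans lb lz (occ_cname_lt haa)); first exact: dv_ent_same hb hz.
    exact: dv_ent_occ hm hy haa.
  have [c [b [e [[h1 _ _ _ _] _]]]] := site_subex hq.
  rewrite GRing.addr0; exists b', (m' + m); split=> //.
    by rewrite PoszD GRing.addrA.
  apply: (dv_ent_trans lx (occ_cname_lt h1) (occ_cname_lt hb')) hd.
  exact: dv_ent_occ hm' hy' h1.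
- rewrite GRing.addr0 => -[y [m [lx -> hy hm]]].
  have [c [b [e [[h1 _ h2 _ _] _]]]] := site_subex h.
  (* The witness is created at the current time by the occurrence of [B] in this very inclusion. *)
  exists (inr (b, (j + Posz m)%R)); split.
    exists b, 0; split=> //; [exact: occ_cname_lt h2 | by rewrite GRing.addr0 |].
    exact: (dv_ent_same h2 h2).
  by exists y, m, A, B.
Qed.

(** From right to left, the entailment is evaluated in the canonical model at the element that [A]
    creates at time 0: its membership in [B] at time [m] is a derivation of the word of length [m],
    up to the choice of an occurrence of [B]. *)
Lemma dv_ent_iff x y m A B : occ w x (code_cname A) -> occ w y (code_cname B) ->
  dv P_ent x y m <-> entails T (Name A) (Next (Posz m) B).
Proof.
move=> hx hy; have lx := occ_cname_lt hx; have ly := occ_cname_lt hy.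
split=> [h|/entails_next h].
  have : meaning T P_ent x y m.
    apply: (derivable_sound clauses_ok (meaning_closed T_future)) h => //.
      exact: ltn_addr.
    exact: ltn_addr.
  by case/(_ _ hx)=> B' /(occ_cname_inj hy) <-.
have h0 : canon_cext 0 A (inr (x, 0%R)).
  by exists x, 0; split=> //; apply: (dv_ent_same hx hx).
have [y' [m' [_ E hy' hm']]] := h canon canon_model 0%R (inr (x, 0%R)) h0.
have -> : m = m' by move: E; rewrite !GRing.add0r => -[].
exact: dv_ent_occ hm' hy' hy.
Qed.

End Model.

Theorem theorem5 (V : vocabulary) :
  exists G : tbox V -> unary_grammar,
    poly_time_computable (@code_tbox V)
      (fun H : unary_grammar => code_grammar H) (@future V) G /\
    forall T : tbox V, future T ->
    forall A B : cname V, A \in tbox_cnames T -> B \in tbox_cnames T ->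
    exists NAB : nonterminal (G T),
    forall n : nat,
      language (G T) (inl NAB) (nseq n tt) <->
      entails T (Name A) (Next (Posz n) B).
Proof.
exists (fun T => gram clauses (code_tbox T)); split.
  have [M [P hM]] := prog_poly_time (pgram_scoped clauses_ok).
  by exists M, P => T _; rewrite -(den_gram _ clauses_ok).
move=> T hT A B /cname_at[x hx] /cname_at[y hy].
by exists (nt (code_tbox T) P_ent x y) => m; apply: dv_ent_iff.
Qed.
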